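(* Let $R$ be an associative ring. Then: (a) in any acyclic complex of fp-projective $R$-modules, all the modules of cocycles are weakly fp-projective; (b) if $P^\bullet$ is a complex of fp-projective $R$-modules and $J^\bullet$ is an acyclic complex of fp-injective $R$-modules with fp-injective modules of cocycles, then every morphism of complexes $P^\bullet\to J^\bullet$ is homotopic to zero.
   Context: Rings are associative and unital; ''$R$-module'' means a right $R$-module (or a left one, with the side fixed throughout). Complexes are $\mathbb Z$-indexed and may be unbounded in both directions. An $R$-module $J$ is fp-injective if $\operatorname{Ext}^1_R(T,J)=0$ for all finitely presented $R$-modules $T$. An $R$-module $P$ is fp-projective if $\operatorname{Ext}^1_R(P,J)=0$ for all fp-injective $R$-modules $J$. An $R$-module $J$ is strongly fp-injective if $\operatorname{Ext}^n_R(T,J)=0$ for all finitely presented $R$-modules $T$ and all $n\ge 1$. An $R$-module $P$ is weakly fp-projective if $\operatorname{Ext}^1_R(P,J)=0$ for all strongly fp-injective $R$-modules $J$. *)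

(* Defs.v *)
From HB Require Import structures.
From mathcomp Require Import all_boot all_order all_algebra.

Set Implicit Arguments.
Unset Strict Implicit.
Unset Printing Implicit Defensive.

Import GRing.Theory.
Local Open Scope ring_scope.

(* R-modules are left modules (lmodType R) over an arbitrary, possibly zero,
   ring; right R-modules are covered by taking the converse ring R^c. *)

Section Kernel.
Variables (R : pzRingType) (U V : lmodType R) (f : {linear U -> V}).

Definition ker_pred : {pred U} := fun x => f x == 0.

Fact ker_submod_closed : submod_closed ker_pred.
Proof.
split=> [|a x y]; rewrite !unfold_in ?linear0 // => /eqP fx /eqP fy.
by rewrite linearP fx fy scaler0 addr0.
Qed.

HB.instance Definition _ :=
  GRing.isSubmodClosed.Build R U ker_pred ker_submod_closed.

Record ker : Type := Ker { ker_val : U; _ : ker_val \in ker_pred }.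

HB.instance Definition _ := [isSub for ker_val].
HB.instance Definition _ := [Choice of ker by <:].
HB.instance Definition _ := [SubChoice_isSubZmodule of ker by <:].
HB.instance Definition _ := [SubZmodule_isSubLmodule of ker by <:].

End Kernel.

Section Ext.
Variable R : pzRingType.

Definition surjective (U V : lmodType R) (f : {linear U -> V}) : Prop :=
  forall y, exists x, f x = y.

Definition exact_at (U V W : lmodType R)
    (f : {linear U -> V}) (g : {linear V -> W}) : Prop :=
  forall y, g y = 0 <-> exists x, f x = y.

Definition finitely_presented (T : lmodType R) : Prop :=
  exists (m n : nat) (f : {linear 'rV[R]_m -> 'rV[R]_n})
    (g : {linear 'rV[R]_n -> T}), exact_at f g /\ surjective g.

Definition projective (P : lmodType R) : Prop :=
  forall (M N : lmodType R) (p : {linear M -> N}) (f : {linear P -> N}),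
    surjective p -> exists g : {linear P -> M}, forall x, p (g x) = f x.

Record projective_resolution (T : lmodType R) := ProjectiveResolution {
  res_mod :> nat -> lmodType R;
  res_diff : forall n, {linear res_mod n.+1 -> res_mod n};
  res_aug : {linear res_mod 0%N -> T};
  res_projective : forall n, projective (res_mod n);
  res_aug_surj : surjective res_aug;
  res_exact0 : exact_at (res_diff 0%N) res_aug;
  res_exact : forall n, exact_at (res_diff n.+1) (res_diff n)
}.

(* Cocycles and coboundaries of degree n in the cochain complex
   Hom(P_0, J) -> Hom(P_1, J) -> Hom(P_2, J) -> ... *)
Definition Hom_cocycle (T J : lmodType R) (P : projective_resolution T)
    (n : nat) (phi : {linear P n -> J}) : Prop :=
  forall x, phi (res_diff P n x) = 0.

Definition Hom_coboundary (T J : lmodType R) (P : projective_resolution T)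
    (n : nat) : {linear P n -> J} -> Prop :=
  match n with
  | 0 => fun phi => forall x, phi x = 0
  | m.+1 => fun phi => exists psi : {linear P m -> J},
      forall x, phi x = psi (res_diff P m x)
  end.

(* Ext^n_R(T, J) = 0, where Ext^n_R(T, J) is the n-th cohomology group of
   Hom_R(P_*, J) for a projective resolution P_* of T. This group is independent
   of P_* up to isomorphism, and resolutions always exist (by free modules on
   the underlying types of modules), so quantifying over all of them is
   harmless. *)
Definition Ext_eq0 (n : nat) (T J : lmodType R) : Prop :=
  forall (P : projective_resolution T) (phi : {linear P n -> J}),
    Hom_cocycle phi -> Hom_coboundary phi.

Definition fp_injective (J : lmodType R) : Prop :=
  forall T : lmodType R, finitely_presented T -> Ext_eq0 1 T J.

Definition fp_projective (P : lmodType R) : Prop :=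
  forall J : lmodType R, fp_injective J -> Ext_eq0 1 P J.

Definition strongly_fp_injective (J : lmodType R) : Prop :=
  forall T : lmodType R, finitely_presented T ->
    forall n : nat, (1 <= n)%N -> Ext_eq0 n T J.

Definition weakly_fp_projective (P : lmodType R) : Prop :=
  forall J : lmodType R, strongly_fp_injective J -> Ext_eq0 1 P J.

End Ext.

Section Complexes.
Variable R : pzRingType.

Record complex := Complex {
  cplx_mod :> int -> lmodType R;
  cplx_diff : forall i, {linear cplx_mod i -> cplx_mod (i + 1)};
  cplx_diffK : forall i x, cplx_diff (i + 1) (cplx_diff i x) = 0
}.

Definition cocycles (C : complex) (i : int) : lmodType R :=
  ker (cplx_diff C i).

Definition acyclic (C : complex) : Prop :=
  forall i, exact_at (cplx_diff C i) (cplx_diff C (i + 1)).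

Record complex_morphism (C D : complex) := ComplexMorphism {
  cmor :> forall i, {linear C i -> D i};
  cmor_comm : forall i x,
    cmor (i + 1) (cplx_diff C i x) = cplx_diff D i (cmor i x)
}.

(* The homotopy h^(i+1) : C^(i+1) -> D^i is indexed by its target degree, so
   that f^(i+1) = d h^(i+1) + h^(i+2) d typechecks without casts; every integer
   is of the form i + 1. *)
Definition null_homotopic (C D : complex) (f : complex_morphism C D) : Prop :=
  exists h : forall i, {linear C (i + 1) -> D i},
    forall i (x : C (i + 1)),
      f (i + 1) x = cplx_diff D i (h i x) + h (i + 1) (cplx_diff C (i + 1) x).

End Complexes.

(* Main.v *)
(* Fp-projective modules are direct summands of cellular modules: modules built
   by successively adjoining finitely many generators subject to finitely many
   relations, chosen so that the kernel onto the given module is fp-injective.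
   Cells have finite closures, so a cellular module has a family of submodules
   (Hill's lemma) closed under unions of chains in which every member N lies in
   some N' containing a prescribed element, with N'/N finitely presented. If s
   and p split off P^i from the cellular M^i, then s d p is a differential on M
   and P becomes a retract of the complex M, so for (b) one may assume that P
   consists of cellular modules.

   A null-homotopy is then built by Zorn's lemma on subcomplexes from the Hill
   families. Enlarging such a subcomplex by one element in degree i enlarges it
   by a finitely presented module in each degree >= i, since differentials of
   finitely many generators are finitely many elements. The homotopy extends
   because the J^i are fp-injective, and the error it leaves is a morphism from
   a bounded below complex of finitely presented modules to J. That morphism is
   null-homotopic because maps from a finitely presented module to a cocycle
   module Z^(i+1) of J lift to J^i, the module Z^i being fp-injective.

   For (a), let J be strongly fp-injective. The cosyzygies of J in an injective
   coresolution are again strongly fp-injective, so part (b) applies to maps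
   from P to 0 -> J -> E_0 -> E_1 -> ..., and shows that every map from a
   cocycle module Z^i of P to J extends to P^i. Together with
   Ext^1(P^i, J) = 0 this gives Ext^1(Z^(i+1), J) = 0. *)
From HB Require Import structures.
Require Import Defs.
From mathcomp Require Import all_boot all_order all_algebra.
From mathcomp Require Import boolp classical_sets.

Set Implicit Arguments.
Unset Strict Implicit.
Unset Printing Implicit Defensive.

Import GRing.Theory.
Local Open Scope ring_scope.
Local Open Scope quotient_scope.

(** * Modules *)

Section LinearMaps.
Variable R : pzRingType.

Lemma linear_ex (U V : lmodType R) (f : U -> V) :
  linear f -> {g : {linear U -> V} | g =1 f}.
Proof.
move=> lf; pose aux := GRing.isLinear.Build R U V *:%R f lf.
pose g : {linear U -> V} := HB.pack f aux.
by exists g.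
Qed.

Lemma linear_factor (U V W : lmodType R) (u : {linear U -> V})
    (f : {linear U -> W}) :
  surjective u -> (forall x, u x = 0 -> f x = 0) ->
  {g : {linear V -> W} | forall x, g (u x) = f x}.
Proof.
move=> su kf; have [s us] := choice su.
have uf x y : u x = u y -> f x = f y.
  by move=> /eqP; rewrite -subr_eq0 -linearB => /eqP /kf /eqP;
    rewrite linearB subr_eq0 => /eqP.
have [a x y|g gE] := @linear_ex V W (fun y => f (s y)).
  by rewrite -linearP; apply: uf; rewrite linearP !us.
by exists g => x; rewrite gE; apply: uf; rewrite us.
Qed.

Lemma linear_lift_ker (U V W : lmodType R) (f : {linear U -> V})
    (g : {linear V -> W}) :
  (forall x, g (f x) = 0) ->
  {h : {linear U -> ker g} | forall x, ker_val (h x) = f x}.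
Proof.
move=> gf; have kf x : f x \in ker_pred g by apply/eqP.
have [a x y|h hE] := @linear_ex U (ker g) (fun x => Ker (kf x)).
  by apply: val_inj; rewrite /= linearP.
by exists h => x; rewrite hE.
Qed.

Lemma ker_valK (V W : lmodType R) (g : {linear V -> W}) (x : ker g) :
  g (ker_val x) = 0.
Proof. by case: x => x /= /eqP. Qed.

Lemma rV_linear (n : nat) (V : lmodType R) (m : 'I_n -> V) :
  {f : {linear 'rV[R]_n -> V} | forall v, f v = \sum_i v 0 i *: m i}.
Proof.
apply: linear_ex => a x y; rewrite scaler_sumr -big_split /=.
by apply: eq_bigr => i _; rewrite !mxE scalerDl scalerA.
Qed.

Lemma rV_linearE (n : nat) (V : lmodType R) (f : {linear 'rV[R]_n -> V}) v :
  f v = \sum_i v 0 i *: f (delta_mx 0 i).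
Proof.
by rewrite {1}(row_sum_delta v) linear_sum; apply: eq_bigr => i _; rewrite linearZ.
Qed.

(** Related values are chosen on the basis vectors only; closure of [Q] under linear combinations
    carries the relation to all vectors. Lifts out of free modules of finite rank are obtained in
    this form. *)
Lemma rV_choice (n : nat) (V : lmodType R) (Q : 'rV[R]_n -> V -> Prop) :
  (forall x, exists y, Q x y) ->
  (forall a x y x' y', Q x x' -> Q y y' -> Q (a *: x + y) (a *: x' + y')) ->
  Q 0 0 ->
  {f : {linear 'rV[R]_n -> V} | forall x, Q x (f x)}.
Proof.
move=> Qex Ql Q0; have [m mP] := choice (fun i => Qex (delta_mx 0 i)).
have [f fE] := rV_linear m; exists f => v.
rewrite fE {1}(row_sum_delta v); elim/big_rec2: _ => // i x y _ Qxy.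
exact: Ql.
Qed.

Lemma rV_projective n : projective 'rV[R]_n.
Proof.
move=> M N p f sp; have [x|a x y x' y'||g gE] := @rV_choice n M
  (fun x y => p y = f x); last by exists g.
- exact: sp.
- by rewrite !linearP => -> ->.
- by rewrite !linear0.
Qed.

End LinearMaps.

(** * Submodules and quotient modules *)

Section Quotient.
Variables (R : pzRingType) (V : lmodType R).

Definition submodule (U : V -> Prop) : Prop :=
  U 0 /\ forall a x y, U x -> U y -> U (a *: x + y).

Lemma submoduleD U x y : submodule U -> U x -> U y -> U (x + y).
Proof. by case=> _ UP Ux /(UP 1 _ _ Ux); rewrite scale1r. Qed.

Lemma submoduleZ U a x : submodule U -> U x -> U (a *: x).
Proof. by case=> U0 UP Ux; have := UP a _ _ Ux U0; rewrite addr0. Qed.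

Lemma submoduleN U x : submodule U -> U x -> U (- x).
Proof. by move=> sU Ux; rewrite -scaleN1r; exact: submoduleZ. Qed.

Lemma submoduleB U x y : submodule U -> U x -> U y -> U (x - y).
Proof. by move=> sU Ux /(submoduleN sU); exact: submoduleD. Qed.

Lemma submodule_sum U (I : Type) (r : seq I) (P : pred I) (F : I -> V) :
  submodule U -> (forall i, P i -> U (F i)) -> U (\sum_(i <- r | P i) F i).
Proof.
by move=> sU UF; elim/big_ind: _ => //; [case: sU | move=> *; exact: submoduleD].
Qed.

Variables (U : V -> Prop) (sU : submodule U).

(** Submodules are [Prop]-valued, which suits unions of chains; the quotient construction takes this
    classical boolean version. *)
Definition submod_pred of submodule U : {pred V} := fun x => `[< U x >].
Local Notation UP := (submod_pred sU).

Fact submod_pred_closed : submod_closed UP.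
Proof.
case: (sU) => U0 Ul; split=> [|a x y]; first exact/asboolP.
by move=> /asboolP Ux /asboolP Uy; apply/asboolP; exact: Ul.
Qed.

HB.instance Definition _ := GRing.isSubmodClosed.Build R V UP submod_pred_closed.

Definition quot_mod : Type := Quotient.quot (UP : zmodClosed V).
HB.instance Definition _ := Choice.on quot_mod.
HB.instance Definition _ := GRing.Zmodule.on quot_mod.

Local Notation pi := (\pi_(Quotient.quot (UP : zmodClosed V)) : V -> quot_mod).

Lemma quot_pi_eq x y : pi x = pi y <-> U (x - y).
Proof.
split=> [/eqP|Uxy]; first by rewrite -Quotient.idealrBE => /asboolP.
by apply/eqP; rewrite -Quotient.idealrBE; apply/asboolP.
Qed.

Lemma quot_piD x y : pi (x + y) = pi x + pi y.
Proof. exact: (Quotient.pi_add (UP : zmodClosed V) x y). Qed.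

Definition quot_scale (a : R) (x : quot_mod) : quot_mod :=
  pi (a *: repr (x : Quotient.quot (UP : zmodClosed V))).

Lemma quot_piZ a x : pi (a *: x) = quot_scale a (pi x).
Proof.
apply/quot_pi_eq; rewrite -scalerBr; apply: submoduleZ => //.
by apply/quot_pi_eq; rewrite reprK.
Qed.

Lemma quot_ind (P : quot_mod -> Prop) : (forall x, P (pi x)) -> forall x, P x.
Proof. by move=> Ppi x; rewrite -(reprK (x : Quotient.quot (UP : zmodClosed V))). Qed.

Fact quot_scaleA a b x :
  quot_scale a (quot_scale b x) = quot_scale (a * b) x.
Proof. by elim/quot_ind: x => x; rewrite -!quot_piZ scalerA. Qed.

Fact quot_scale1 : left_id 1 quot_scale.
Proof. by elim/quot_ind => x; rewrite -quot_piZ scale1r. Qed.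

Fact quot_scaleDr : right_distributive quot_scale +%R.
Proof.
move=> a; elim/quot_ind => x; elim/quot_ind => y.
by rewrite -quot_piD -!quot_piZ scalerDr quot_piD.
Qed.

Fact quot_scaleDl v : {morph quot_scale^~ v : a b / a + b}.
Proof. by elim/quot_ind: v => x a b; rewrite -!quot_piZ scalerDl quot_piD. Qed.

HB.instance Definition _ := GRing.Zmodule_isLmodule.Build R quot_mod
  quot_scaleA quot_scale1 quot_scaleDr quot_scaleDl.

Lemma quotient_ex : exists (Q : lmodType R) (p : {linear V -> Q}),
  surjective p /\ forall x, p x = 0 <-> U x.
Proof.
have [a x y|p pE] := @linear_ex R V quot_mod pi.
  by rewrite quot_piD quot_piZ.
exists quot_mod, p; split=> [|x]; first by elim/quot_ind => x; exists x.
by rewrite -(linear0 p) !pE quot_pi_eq subr0.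
Qed.

End Quotient.

(** * Direct sums over an arbitrary index type *)

Section DirectSum.
Variables (R : pzRingType) (I : choiceType) (V : I -> lmodType R).

Record dirsum := DirSum {
  ds_fun :> forall i, V i;
  ds_fin : exists s : seq I, forall i, i \notin s -> ds_fun i = 0
}.

Lemma dirsumP (u v : dirsum) : (forall i, u i = v i) -> u = v.
Proof.
case: u v => [u uP] [v vP] /= uv.
have euv : u = v by exact: functional_extensionality_dep.
by case: _ / euv vP => vP; congr DirSum.
Qed.

Fact ds_zero_fin : exists s : seq I, forall i, i \notin s -> (0 : V i) = 0.
Proof. by exists [::]. Qed.

Fact ds_opp_fin (u : dirsum) :
  exists s : seq I, forall i, i \notin s -> - u i = 0.
Proof. by case: (ds_fin u) => s us; exists s => i /us ->; rewrite oppr0. Qed.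

Fact ds_add_fin (u v : dirsum) :
  exists s : seq I, forall i, i \notin s -> u i + v i = 0.
Proof.
case: (ds_fin u) (ds_fin v) => s us [t vt]; exists (s ++ t) => i.
by rewrite mem_cat negb_or => /andP[/us -> /vt ->]; rewrite addr0.
Qed.

Fact ds_scale_fin a (u : dirsum) :
  exists s : seq I, forall i, i \notin s -> a *: u i = 0.
Proof. by case: (ds_fin u) => s us; exists s => i /us ->; rewrite scaler0. Qed.

HB.instance Definition _ := gen_eqMixin dirsum.
HB.instance Definition _ := gen_choiceMixin dirsum.

Definition ds_zero := DirSum ds_zero_fin.
Definition ds_opp u := DirSum (ds_opp_fin u).
Definition ds_add u v := DirSum (ds_add_fin u v).
Definition ds_scale a u := DirSum (ds_scale_fin a u).

Fact ds_addA : associative ds_add.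
Proof. by move=> u v w; apply: dirsumP => i /=; rewrite addrA. Qed.
Fact ds_addC : commutative ds_add.
Proof. by move=> u v; apply: dirsumP => i /=; rewrite addrC. Qed.
Fact ds_add0 : left_id ds_zero ds_add.
Proof. by move=> u; apply: dirsumP => i /=; rewrite add0r. Qed.
Fact ds_addN : left_inverse ds_zero ds_opp ds_add.
Proof. by move=> u; apply: dirsumP => i /=; rewrite addNr. Qed.

HB.instance Definition _ :=
  GRing.isZmodule.Build dirsum ds_addA ds_addC ds_add0 ds_addN.

Fact ds_scaleA a b u : ds_scale a (ds_scale b u) = ds_scale (a * b) u.
Proof. by apply: dirsumP => i /=; rewrite scalerA. Qed.
Fact ds_scale1 : left_id 1 ds_scale.
Proof. by move=> u; apply: dirsumP => i /=; rewrite scale1r. Qed.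
Fact ds_scaleDr : right_distributive ds_scale +%R.
Proof. by move=> a u v; apply: dirsumP => i /=; rewrite scalerDr. Qed.
Fact ds_scaleDl u : {morph ds_scale^~ u : a b / a + b}.
Proof. by move=> a b; apply: dirsumP => i /=; rewrite scalerDl. Qed.

HB.instance Definition _ := GRing.Zmodule_isLmodule.Build R dirsum
  ds_scaleA ds_scale1 ds_scaleDr ds_scaleDl.

Lemma dsD (u v : dirsum) i : (u + v) i = u i + v i. Proof. by []. Qed.
Lemma dsZ a (u : dirsum) i : (a *: u) i = a *: u i. Proof. by []. Qed.
Lemma dsB (u v : dirsum) i : (u - v) i = u i - v i. Proof. by []. Qed.

Lemma ds_sum (J : Type) (r : seq J) (F : J -> dirsum) i :
  (\sum_(j <- r) F j) i = \sum_(j <- r) F j i.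
Proof. by elim/big_rec2: _ => // j x y _ <-. Qed.

Lemma ds_in_fin i (x : V i) : exists s : seq I, forall j, j \notin s ->
  dfwith (fun j => 0 : V j) x j = 0.
Proof.
by exists [:: i] => j; rewrite inE eq_sym => /(dfwith_out (fun j => 0 : V j) x).
Qed.

Definition ds_in i (x : V i) : dirsum := DirSum (ds_in_fin x).

Lemma ds_in_eq i (x : V i) : ds_in x i = x.
Proof. exact: dfwith_in. Qed.

Lemma ds_in_neq i j (x : V i) : i != j -> ds_in x j = 0.
Proof. exact: dfwith_out. Qed.

Lemma ds_in_linear i : linear (@ds_in i).
Proof.
move=> a x y; apply: dirsumP => j; rewrite dsD dsZ.
have [ij|ij] := eqVneq i j; first by case: _ / ij; rewrite !ds_in_eq.
by rewrite !ds_in_neq // scaler0 addr0.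
Qed.

HB.instance Definition _ i :=
  GRing.isLinear.Build R (V i) dirsum *:%R (@ds_in i) (@ds_in_linear i).

Definition ds_inl i : {linear V i -> dirsum} := @ds_in i.

Lemma ds_sumE (u : dirsum) (s : seq I) :
  uniq s -> (forall i, i \notin s -> u i = 0) ->
  u = \sum_(i <- s) ds_in (u i).
Proof.
move=> us u0; apply: dirsumP => i; rewrite ds_sum.
have [si|si] := boolP (i \in s); last first.
  rewrite u0 // big1_seq // => j /andP[_ sj]; rewrite ds_in_neq //.
  by apply: contraNneq si => <-.
rewrite (bigD1_seq i) // ds_in_eq big1 => [|j ji]; first exact/esym/addr0.
by rewrite ds_in_neq.
Qed.

Lemma ds_submodule (U : dirsum -> Prop) (u : dirsum) :
  submodule U -> (forall i, U (ds_in (u i))) -> U u.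
Proof.
move=> sU Uin; case: (ds_fin u) => s us.
rewrite (@ds_sumE u (undup s)) ?undup_uniq //.
  by apply: submodule_sum.
by move=> i; rewrite mem_undup => /us.
Qed.

Lemma ds_linear (W : lmodType R) (f : forall i, {linear V i -> W}) :
  {g : {linear dirsum -> W} | forall i (x : V i), g (ds_in x) = f i x}.
Proof.
pose supp (u : dirsum) := undup (sval (cid (ds_fin u))).
have suppP u i : i \notin supp u -> u i = 0.
  by rewrite mem_undup; apply: (svalP (cid (ds_fin u))).
pose F u := \sum_(i <- supp u) f i (u i).
(* Any duplicate-free list that contains the support gives the same sum, so two vectors can be
   evaluated over a common list. *)
have FE (u : dirsum) s : uniq s -> (forall i, i \notin s -> u i = 0) ->
    F u = \sum_(i <- s) f i (u i).
  move=> us u0.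
  have restrict (t t' : seq I) : (forall i, i \notin t' -> u i = 0) ->
      \sum_(i <- t) f i (u i) = \sum_(i <- t | i \in t') f i (u i).
    move=> ut; rewrite [LHS](bigID (mem t')) /= [X in _ + X]big1 ?addr0 // => i.
    by move/ut ->; rewrite linear0.
  rewrite /F (restrict _ s) // (restrict s (supp u)); last exact: suppP.
  rewrite -[LHS]big_filter -[RHS]big_filter; apply: perm_big; apply: uniq_perm.
  - exact/filter_uniq/undup_uniq.
  - exact: filter_uniq.
  - by move=> i; rewrite !mem_filter andbC.
have [a u v|g gE] := @linear_ex R dirsum W F.
  pose s := undup (supp u ++ supp v).
  have us : uniq s by exact: undup_uniq.
  have [us0 vs0] : (forall i, i \notin s -> u i = 0) /\
                 (forall i, i \notin s -> v i = 0).
    split=> i; rewrite mem_undup mem_cat negb_or => /andP[h1 h2]; exact: suppP.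
  rewrite !(FE _ s) //; last by move=> i is_; rewrite dsD dsZ us0 ?vs0 // scaler0 addr0.
  rewrite scaler_sumr -big_split /=; apply: eq_bigr => i _.
  exact: linearP.
exists g => i x; rewrite gE (FE _ [:: i]) // ?big_seq1 ?ds_in_eq // => j.
by rewrite inE eq_sym => /ds_in_neq.
Qed.

Lemma ds_linear_eq (W : lmodType R) (f g : {linear dirsum -> W}) :
  (forall i (x : V i), f (ds_in x) = g (ds_in x)) -> f =1 g.
Proof.
move=> fg u; apply: (@ds_submodule (fun u => f u = g u)) => // {u}.
by split=> [|a u v fgu fgv]; rewrite ?linear0 // !linearP fgu fgv.
Qed.

End DirectSum.

Section Support.
Variable R : pzRingType.

Lemma preim_submodule (U V : lmodType R) (f : {linear U -> V}) (N : V -> Prop) :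
  submodule N -> submodule (fun x => N (f x)).
Proof.
case=> N0 Nl; split=> [|a x y Nx Ny]; first by rewrite linear0.
by rewrite linearP; exact: Nl.
Qed.

Variables (I : choiceType) (V : I -> lmodType R).

Definition supported (S : I -> Prop) (x : dirsum V) : Prop :=
  forall i, x i <> 0 -> S i.

Lemma supported_submodule S : submodule (supported S).
Proof.
split=> [i /= []//|a x y Sx Sy i xyi].
have [xi|/Sx //] := pselect (x i = 0); have [yi|/Sy //] := pselect (y i = 0).
by case: xyi; rewrite dsD dsZ xi yi scaler0 addr0.
Qed.

Lemma supported_in S i (v : V i) : S i -> supported S (ds_in v).
Proof.
move=> Si j; have [<- //|ij] := eqVneq i j.
by rewrite ds_in_neq.
Qed.

Lemma ds_submodule_preim (W : lmodType R)
    (f : {linear dirsum V -> W}) (N : W -> Prop) (x : dirsum V) :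
  submodule N -> (forall i, x i <> 0 -> N (f (ds_in (x i)))) -> N (f x).
Proof.
move=> sN fx; apply: (ds_submodule (U := fun x => N (f x))) => [|i].
  exact: preim_submodule.
have [-> | /fx //] := pselect (x i = 0).
by rewrite !linear0; case: sN.
Qed.

End Support.

(** * Ext^1, lifting and fp-injectivity *)

Section Ext1.
Variable R : pzRingType.

Lemma linear_lift_inj (U V W : lmodType R) (i : {linear V -> W})
    (f : {linear U -> W}) :
  (forall y, i y = 0 -> y = 0) -> (forall x, exists y, i y = f x) ->
  {g : {linear U -> V} | forall x, i (g x) = f x}.
Proof.
move=> i0 fi; have [s sE] := choice fi.
have [a x y|g gE] := @linear_ex R U V s; last by exists g => x; rewrite gE.
apply/eqP; rewrite -subr_eq0; apply/eqP/i0.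
by rewrite linearB linearP !sE linearP subrr.
Qed.

Definition free_mod (X : choiceType) : lmodType R :=
  @dirsum R X (fun=> R^o : lmodType R).

Definition free_gen (X : choiceType) (x : X) : free_mod X :=
  @ds_in R X (fun=> R^o : lmodType R) x (1 : R).

Lemma free_linear (X : choiceType) (W : lmodType R) (w : X -> W) :
  {g : {linear free_mod X -> W} | forall x, g (free_gen x) = w x}.
Proof.
have sl x : linear ((fun a : R => a *: w x) : R^o -> W).
  by move=> a b c; rewrite scalerDl scalerA.
have [g gE] := @ds_linear R X (fun=> R^o : lmodType R) W
  (fun x => sval (linear_ex (sl x))).
by exists g => x; rewrite gE; case: linear_ex => h /= ->; rewrite scale1r.
Qed.

Lemma free_linear_eq (X : choiceType) (W : lmodType R)
    (f g : {linear free_mod X -> W}) :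
  (forall x, f (free_gen x) = g (free_gen x)) -> f =1 g.
Proof.
move=> fg; apply: ds_linear_eq => x a.
have -> : @ds_in R X (fun=> R^o : lmodType R) x a = (a : R) *: free_gen x.
  have := linearZZ (@ds_in R X (fun=> R^o : lmodType R) x : {linear _ -> _}) a 1.
  by move=> <-; congr (ds_in _); exact/esym/mulr1.
by rewrite !linearZ fg.
Qed.

Lemma free_projective (X : choiceType) : projective (free_mod X).
Proof.
move=> M N p f sp; have [s ps] := choice (fun x : X => sp (f (free_gen x))).
have [g gE] := free_linear s; exists g.
by apply: (@free_linear_eq _ _ (p \o g)%FUN f) => x /=; rewrite gE ps.
Qed.

Lemma free_cover_ex (V : lmodType R) :
  exists (F : lmodType R) (p : {linear F -> V}), projective F /\ surjective p.
Proof.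
have [p pE] := @free_linear V V id; exists (free_mod V), p.
by split=> [|x]; [exact: free_projective | exists (free_gen x); rewrite pE].
Qed.

Lemma ker_cover_ex (A B : lmodType R) (f : {linear A -> B}) :
  exists (F : lmodType R) (p : {linear F -> A}), projective F /\ exact_at p f.
Proof.
have [F [p [pF sp]]] := free_cover_ex (ker f).
have [a x y|q qE] := @linear_ex R F A (fun x => ker_val (p x)).
  by rewrite linearP.
exists F, q; split=> // y; split=> [fy|[x <-]]; last by rewrite qE ker_valK.
have fyP : y \in ker_pred f by apply/eqP.
by have [x px] := sp (Ker fyP); exists x; rewrite qE px.
Qed.

(** Maps are bundled with domain and codomain so that a resolution can be built by plain recursion,
    each arrow ending where the previous one starts. *)
Record arrow := Arrow {
  arrow_dom : lmodType R;
  arrow_cod : lmodType R;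
  arrow_map : {linear arrow_dom -> arrow_cod}
}.

Definition next_arrow (a : arrow) : arrow :=
  Arrow (sval (cid (svalP (cid (ker_cover_ex (arrow_map a)))))).

Lemma next_arrowP a : projective (arrow_dom (next_arrow a)) /\
  exact_at (arrow_map (next_arrow a) : {linear _ -> arrow_dom a}) (arrow_map a).
Proof.
exact: (svalP (cid (svalP (cid (ker_cover_ex (arrow_map a)))))).
Qed.

Fixpoint arrow_seq (a : arrow) (n : nat) : arrow :=
  if n is m.+1 then next_arrow (arrow_seq a m) else a.

Section Resolution.
Variables (A B T : lmodType R) (f : {linear A -> B}) (g : {linear B -> T}).
Hypotheses (pA : projective A) (pB : projective B).
Hypotheses (fg : exact_at f g) (sg : surjective g).

Let S := arrow_seq (Arrow f).

Let S_projective n : projective (arrow_cod (S n)).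
Proof.
case: n => [|[|n]] //; rewrite /S /=.
by case: (next_arrowP (arrow_seq (Arrow f) n)).
Qed.

Let S_exact n : exact_at (arrow_map (S n.+1) : {linear _ -> arrow_cod (S n.+1)})
  (arrow_map (S n)).
Proof. by case: (next_arrowP (S n)). Qed.

Definition resolution_extending : projective_resolution T :=
  @ProjectiveResolution R T (fun n => arrow_cod (S n)) (fun n => arrow_map (S n))
    g S_projective sg fg S_exact.

(** [Ext_eq0] ranges over all projective resolutions, in particular over the one that continues [f]
    and [g]; there [w] is a cocycle of degree 1. *)
Lemma Ext1_extend (J : lmodType R) (w : {linear A -> J}) :
  Ext_eq0 1 T J -> (forall x, f x = 0 -> w x = 0) ->
  exists y : {linear B -> J}, forall x, w x = y (f x).
Proof.
move=> E fw; apply: (E resolution_extending w) => x.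
by apply: fw; apply/(@S_exact 0%N); exists x.
Qed.

End Resolution.

(** A lift [a] of the cover [q] along [p] restricts on the relations to a cocycle [w] in [J]. If [y]
    extends [w], then [a - i y] kills the relations and descends to a section. *)
Lemma Ext1_split (T J X : lmodType R) (i : {linear J -> X})
    (p : {linear X -> T}) :
  Ext_eq0 1 T J -> (forall j, i j = 0 -> j = 0) -> exact_at i p ->
  surjective p -> exists s : {linear T -> X}, forall t, p (s t) = t.
Proof.
move=> E i0 ip sp.
have [F [q [pF sq]]] := free_cover_ex T.
have [G [d [pG dq]]] := ker_cover_ex q.
have [a aE] := pF _ _ p q sp.
have ad x : exists j, i j = (a \o d)%FUN x.
  by apply/ip; rewrite /= aE; apply/dq; exists x.
have [w wE] := linear_lift_inj i0 ad.
have [|y yE] := Ext1_extend pG pF dq sq E (w := w).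
  by move=> x dx; apply: i0; rewrite wE /= dx linear0.
have [|s sE] := @linear_factor R F T X q (a \- (i \o y))%R sq.
  by move=> x /dq [z <-]; rewrite /= -yE wE subrr.
exists s => t; have [x <-] := sq t; rewrite sE linearB /= aE.
have -> : p (i (y x)) = 0 by apply/ip; exists (y x).
by rewrite subr0.
Qed.

(** The extension to be split is the pushout of [Q 0] along [phi], namely the quotient of [J * Q 0]
    by the pairs [(phi y, - d y)]. Injectivity of [J -> X] uses that [phi] is a cocycle. *)
Lemma split_Ext1 (T J : lmodType R) :
  (forall (X : lmodType R) (i : {linear J -> X}) (p : {linear X -> T}),
    (forall j, i j = 0 -> j = 0) -> exact_at i p -> surjective p ->
    exists s : {linear T -> X}, forall t, p (s t) = t) ->
  Ext_eq0 1 T J.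
Proof.
move=> sp Q phi cphi; pose d : {linear Q 1%N -> Q 0%N} := res_diff Q 0.
pose U (z : J * Q 0%N) := exists y, z = (phi y, - d y).
have sU : submodule U.
  split=> [|a _ _ [x ->] [y ->]]; first by exists 0; rewrite !linear0 ?oppr0.
  by exists (a *: x + y); rewrite linearP linearP opprD -scalerN.
have [X [pi [spi kpi]]] := quotient_ex sU.
have [a x y|i iE] := @linear_ex R J X (fun j => pi (j, 0)).
  by rewrite -linearP; congr (pi _); congr (_, _); rewrite /= scaler0 addr0.
have [a x y|aug augE] := @linear_ex R _ T (fun z : J * Q 0%N => res_aug Q z.2).
  exact: linearP.
have [z /kpi [y ->]|p pE] := linear_factor spi (f := aug).
  rewrite augE /= linearN; apply/eqP; rewrite oppr_eq0.
  by apply/eqP/res_exact0; exists y.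
have i0 j : i j = 0 -> j = 0.
  rewrite iE => /kpi [y [-> /esym/eqP]]; rewrite oppr_eq0 => /eqP dy.
  by have [x <-] : exists x, res_diff Q 1 x = y by apply/res_exact.
have ip : exact_at i p.
  move=> x; have [[j q] <-] := spi x; rewrite pE augE.
  split=> [/res_exact0 [y qE]|[k /(congr1 p)]]; last first.
    by rewrite iE !pE !augE /= linear0.
  exists (j + phi y); rewrite iE; apply/eqP; rewrite -subr_eq0 -linearB.
  by apply/eqP/kpi; exists y; congr (_, _) => /=; rewrite ?sub0r ?qE // addrC addKr.
have spp : surjective p.
  by move=> t; have [q <-] := res_aug_surj Q t; exists (pi (0, q)); rewrite pE augE.
have [s sE] := sp X i p i0 ip spp.
(* The class of [(0, q)] minus the section over the image of [q] lies in [J]; this gives the cochain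
   whose coboundary is [phi]. *)
have [a x y|b bE] := @linear_ex R (Q 0%N) X (fun q => pi (0, q) - s (res_aug Q q)).
  have -> : (0, a *: x + y) = a *: (0, x) + (0, y) :> J * Q 0%N.
    by congr (_, _); rewrite /= scaler0 addr0.
  by rewrite !linearP scalerBr addrACA /= scalerN.
have bi q : exists j, i j = b q by apply/ip; rewrite bE linearB sE pE augE subrr.
have [psi psiE] := linear_lift_inj i0 bi.
exists psi => y; apply/eqP; rewrite -subr_eq0; apply/eqP/i0.
rewrite linearB psiE iE bE.
have -> : res_aug Q (res_diff Q 0 y) = 0 by apply/res_exact0; exists y.
rewrite linear0 subr0 -linearB; apply/kpi; exists y; congr (_, _) => /=.
  by rewrite subr0.
by rewrite sub0r.
Qed.

(** Absolute purity: a finite system of linear equations with right-hand sides in [J] is solvable in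
    [J] as soon as it is consistent. This is fp-injectivity in a form that avoids resolutions. *)
Definition fp_solvable (J : lmodType R) : Prop :=
  forall m n (f : {linear 'rV[R]_m -> 'rV[R]_n}) (w : {linear 'rV[R]_m -> J}),
    (forall v, f v = 0 -> w v = 0) ->
    exists y : {linear 'rV[R]_n -> J}, forall v, y (f v) = w v.

Lemma fp_injective_solvable J : fp_injective J -> fp_solvable J.
Proof.
move=> Jfp m n f w fw.
have sU : submodule (fun y => exists x, f x = y).
  split=> [|a _ _ [x <-] [y <-]]; first by exists 0; rewrite linear0.
  by exists (a *: x + y); rewrite linearP.
have [T [p [sp fp]]] := quotient_ex sU.
have [|y yE] := Ext1_extend (@rV_projective R m) (@rV_projective R n)
  fp sp (w := w) _ fw.
  by apply: Jfp; exists m, n, f, p.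
by exists y.
Qed.

Lemma solvable_fp_injective J : fp_solvable J -> fp_injective J.
Proof.
move=> solJ T [m [n [f [g [fg sg]]]]]; apply: split_Ext1 => X i p i0 ip sp.
have [a aE] := @rV_projective R n _ _ p g sp.
have af x : exists j, i j = (a \o f)%FUN x.
  by apply/ip; rewrite /= aE; apply/fg; exists x.
have [w wE] := linear_lift_inj i0 af.
have [|y yE] := solJ _ _ f w.
  by move=> x fx; apply: i0; rewrite wE /= fx linear0.
have [|s sE] := @linear_factor R _ T X g (a \- (i \o y))%R sg.
  by move=> x /fg [z <-]; rewrite /= yE wE subrr.
exists s => t; have [x <-] := sg t; rewrite sE linearB /= aE.
have -> : p (i (y x)) = 0 by apply/ip; exists (y x).
by rewrite subr0.
Qed.

End Ext1.

(** * Choice principles and partial linear maps *)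

Lemma dependent_choice_seq (X : nat -> Type) (Q : forall j, X j -> Prop)
    (L : forall j, X j -> X j.+1 -> Prop) (x0 : X 0%N) :
  Q 0%N x0 -> (forall j x, Q j x -> exists y, Q j.+1 y /\ L j x y) ->
  exists s : forall j, X j,
    s 0%N = x0 /\ forall j, Q j (s j) /\ L j (s j) (s j.+1).
Proof.
move=> Q0 QL.
pose next j (x : {x : X j | Q j x}) : {x : X j.+1 | Q j.+1 x} :=
  let y := cid (QL j _ (svalP x)) in exist _ (sval y) (proj1 (svalP y)).
pose t := fix t j : {x : X j | Q j x} :=
  if j is k.+1 then next k (t k) else exist _ x0 Q0.
exists (fun j => sval (t j)); split=> // j; split; first exact: (svalP (t j)).
exact: (proj2 (svalP (cid (QL j _ (svalP (t j)))))).
Qed.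

Section ZornExtension.
Variables (I : Type) (M J : I -> Type).

(** A total function is paired with a domain, and [extends] compares values on the domain only; this
    avoids functions on varying subtypes. *)
Definition partial_fun : Type := (forall i, M i -> Prop) * (forall i, M i -> J i).

Definition extends (p q : partial_fun) : Prop :=
  forall i x, p.1 i x -> q.1 i x /\ q.2 i x = p.2 i x.

(** Zorn's lemma for the preorder [extends], with a maximal element total by the last hypothesis. It
    serves both for null-homotopies and for the injectivity of divisible groups. *)
Lemma zorn_extension (P : partial_fun -> Prop) (p0 : partial_fun) :
  P p0 ->
  (forall (A : partial_fun -> Prop) h,
    (exists p, A p) -> (forall p, A p -> P p) ->
    (forall p q, A p -> A q -> extends p q \/ extends q p) ->
    (forall p i x, A p -> p.1 i x -> h i x = p.2 i x) ->
    P (fun i x => exists2 p, A p & p.1 i x, h)) ->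
  (forall p i x, P p -> ~ p.1 i x ->
    exists q, [/\ P q, extends p q & q.1 i x]) ->
  exists h, P (fun _ _ => True, h).
Proof.
move=> P0 Pchain Pstep.
pose T := {p | P p}; pose t0 : T := exist _ p0 P0.
pose Rl (s t : T) := `[< extends (sval s) (sval t) >].
have refl t : Rl t t by apply/asboolP => i x.
have trans r s t : Rl r s -> Rl s t -> Rl r t.
  move=> /asboolP rs /asboolP st; apply/asboolP => i x rx.
  by have [sx <-] := rs i x rx; exact: st.
have [A totA|t tmax] := ZL_preorder t0 refl trans.
  have [[a Aa]|A0] := pselect (exists a, A a); last first.
    by exists t0 => s As; case: A0; exists s.
  pose A' p := exists2 t : T, A t & sval t = p.
  have A'tot p q : A' p -> A' q -> extends p q \/ extends q p.
    move=> [s As <-] [t At <-].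
    by have [/asboolP|/asboolP] := totA _ _ As At; [left|right].
  (* Off the union of the domains the glued function borrows the values of one member of the chain,
     since [J i] has no default element. *)
  pose h0 := (sval a).2.
  pose h i (x : M i) : J i :=
    if pselect (exists2 p, A' p & p.1 i x) is left e then (sval (cid2 e)).2 i x
    else h0 i x.
  have hE p i x : A' p -> p.1 i x -> h i x = p.2 i x.
    move=> A'p px; rewrite /h; case: pselect => [e|[]]; last by exists p.
    case: cid2 => q A'q qx /=.
    by have [pq|qp] := A'tot _ _ A'p A'q; [case: (pq i x px) | case: (qp i x qx)].
  have Pu : P (fun i x => exists2 p, A' p & p.1 i x, h).
    apply: Pchain => //; first by exists (sval a), a.
    by move=> p [t _ <-]; exact: svalP.
  exists (exist _ _ Pu) => s As; apply/asboolP => i x sx /=.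
  have A's : A' (sval s) by exists s.
  by split; [exists (sval s) | rewrite (hE _ _ _ A's)].
exists (sval t).2; have -> : (fun _ _ => True) = (sval t).1.
  apply: functional_extensionality_dep => i.
  apply: functional_extensionality_dep => x.
  apply: propext; split=> // _; apply: contrapT => tx.
  have [q [Pq tq qx]] := Pstep _ _ _ (svalP t) tx.
  have /asboolP qt := tmax (exist _ q Pq) (asboolT tq).
  by apply: tx; case: (qt i x qx).
by rewrite -surjective_pairing; exact: svalP.
Qed.

End ZornExtension.

Section LinearOn.
Variable R : pzRingType.

Definition linear_on (M J : lmodType R) (N : M -> Prop) (h : M -> J) : Prop :=
  forall a x y, N x -> N y -> h (a *: x + y) = a *: h x + h y.

Variables (M J : lmodType R) (N : M -> Prop) (h : M -> J).
Hypotheses (sN : submodule N) (lh : linear_on N h).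

Lemma linear_on0 : h 0 = 0.
Proof.
have N0 : N 0 by case: sN.
have := lh 1 N0 N0; rewrite !scale1r addr0 => /eqP.
by rewrite -subr_eq0 opprD addNKr oppr_eq0 => /eqP.
Qed.

Lemma linear_onD x y : N x -> N y -> h (x + y) = h x + h y.
Proof. by move=> Nx /(lh 1 Nx); rewrite !scale1r. Qed.

Lemma linear_onZ a x : N x -> h (a *: x) = a *: h x.
Proof.
have N0 : N 0 by case: sN.
by move=> Nx; rewrite -[a *: x]addr0 lh // linear_on0 addr0.
Qed.

Lemma linear_onN x : N x -> h (- x) = - h x.
Proof. by move=> Nx; rewrite -!scaleN1r linear_onZ. Qed.

Lemma linear_onB x y : N x -> N y -> h (x - y) = h x - h y.
Proof. by move=> Nx Ny; rewrite linear_onD ?linear_onN //; exact: submoduleN. Qed.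

(** Two expressions [y + g v] and [y' + g v'] of one element differ by [g (v - v') = y' - y], which
    lies in [N], where [h] and [e] agree. *)
Lemma linear_on_glue (V : lmodType R) (g : {linear V -> M}) (e : {linear V -> J}) :
  (forall v, N (g v) -> h (g v) = e v) ->
  exists h' : M -> J, forall y v, N y -> h' (y + g v) = h y + e v.
Proof.
move=> he.
have [x|h' h'P] := @choice M J
    (fun x z => forall y v, N y -> x = y + g v -> z = h y + e v).
  have [[[y v] [Ny xE]]|nx] := pselect (exists yv : M * V, N yv.1 /\ x = yv.1 + g yv.2);
    last by exists 0 => y v Ny xE; case: nx; exists (y, v).
  exists (h y + e v) => y' v' Ny' xE' /=.
  have gE : g (v - v') = y' - y.
    by apply/eqP; rewrite linearB subr_eq addrAC -xE' xE [y + _]addrC addrK.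
  have Ng : N (g (v - v')) by rewrite gE; exact: submoduleB.
  have eE : e v = h y' - h y + e v'.
    by apply/eqP; rewrite -subr_eq -linearB -he // gE linear_onB.
  by rewrite eE addrA [h y + (_ - _)]addrC subrK.
by exists h' => y v Ny; exact: h'P.
Qed.

End LinearOn.

(** * Bounded below complexes of finitely presented modules *)

Section BoundedBelow.
Variables (R : pzRingType) (K : nat -> lmodType R).
Variable dK : forall j, {linear K j -> K j.+1}.
Hypothesis ddK : forall j x, dK j.+1 (dK j x) = 0.
Hypothesis exK : forall j x, dK j.+1 x = 0 -> exists y, dK j y = x.
Hypothesis solK : forall j, fp_solvable (ker (dK j)).

(** A map from the cokernel of [A] to cocycles is first lifted on the free module. On the relations
    the lift takes values in the kernel of [dK j], and solvability there provides the correction. *)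
Lemma fp_lift j m n (A : {linear 'rV[R]_m -> 'rV[R]_n})
    (phi : {linear 'rV[R]_n -> K j.+1}) :
  (forall v, dK j.+1 (phi v) = 0) -> (forall v, phi (A v) = 0) ->
  exists psi : {linear 'rV[R]_n -> K j},
    (forall v, dK j (psi v) = phi v) /\ forall v, psi (A v) = 0.
Proof.
move=> dphi phiA.
have [v|a x y x' y'||p pE] := @rV_choice R n (K j) (fun v y => dK j y = phi v).
- exact/exK/dphi.
- by rewrite !linearP => -> ->.
- by rewrite !linear0.
have [v|w wE] := @linear_lift_ker R _ _ _ (p \o A)%FUN (dK j).
  by rewrite /= pE phiA.
have [v Av|y yE] := @solK j _ _ A w.
  by apply: val_inj; rewrite /= wE /= Av linear0.
have [a v v'|q qE] := @linear_ex R _ (K j) (fun v => p v - ker_val (y v)).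
  by rewrite !linearP /= scalerBr addrACA scalerN.
exists q; split=> v; first by rewrite qE linearB pE ker_valK subr0.
by rewrite qE yE wE subrr.
Qed.

Variables (n m : nat -> nat).
Variables (A : forall j, {linear 'rV[R]_(m j) -> 'rV[R]_(n j)}).
Variables (D : forall j, {linear 'rV[R]_(n j) -> 'rV[R]_(n j.+1)}).
Variables (phi : forall j, {linear 'rV[R]_(n j) -> K j.+1}).
Hypothesis DA : forall j v, exists u, D j (A j v) = A j.+1 u.
Hypothesis DD : forall j v, exists u, D j.+1 (D j v) = A j.+2 u.
Hypothesis phiA : forall j v, phi j (A j v) = 0.
Hypothesis phiD : forall j v, phi j.+1 (D j v) = dK j.+1 (phi j v).

(* The complex with terms R^(n j) / im (A j) need not be bounded above, so the
   homotopy is built from the bottom: e is a tentative component in degree j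
   for which phi - d e kills the image C of the previous differential, and the
   next step corrects it by a map c that vanishes on C. *)
Let stage_maps j q : Type :=
  ({linear 'rV[R]_q -> 'rV[R]_(n j)} * {linear 'rV[R]_(n j) -> K j})%type.
Let stage j : Type := {q : nat & stage_maps j q}.

Let good j (s : stage j) : Prop :=
  let: existT q (C, e) := s in
  [/\ forall v, phi j (C v) = dK j (e (C v)),
      forall u, exists v, A j u = C v,
      forall v, exists u, D j (C v) = A j.+1 u
    & forall v, e (A j v) = 0].

Let linked j (s : stage j) (s' : stage j.+1) : Prop :=
  let: existT q (C, e) := s in let: existT q' (C', e') := s' in
  (forall v, exists u, D j v = C' u) /\
  exists c : {linear 'rV[R]_(n j) -> K j},
    (forall v, c (C v) = 0) /\
    forall v, phi j v = dK j (e v) + dK j (c v) + e' (D j v).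

Let next_stage j (s : stage j) :
  good s -> exists s' : stage j.+1, good s' /\ linked s s'.
Proof.
case: s => q [C e] [phiC AC DC eA].
have [a x y|C' C'E] := @linear_ex R 'rV_(m j.+1 + n j) 'rV_(n j.+1)
    (fun v => A j.+1 (lsubmx v) + D j (rsubmx v)).
  by rewrite !linearP /= scalerDr addrACA.
have C'A u : C' (row_mx u 0) = A j.+1 u.
  by rewrite C'E row_mxKl row_mxKr linear0 addr0.
have C'D u : C' (row_mx 0 u) = D j u.
  by rewrite C'E row_mxKl row_mxKr linear0 add0r.
(* [C'] spans the relations together with the image of [D j]. Since [dK (phi v)] vanishes on it,
   there is [g] vanishing on [C'] with the same differential as [phi]. *)
have [v|v|g [dg gC']] := @fp_lift j.+2 _ _ C' (dK j.+2 \o phi j.+1)%FUN.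
- exact: ddK.
- by rewrite /= C'E linearD phiA add0r phiD ddK.
(* [phi - g] takes values in cocycles, so it is [dK e']; hence [phi - dK e'] equals [g] and kills
   [C']. *)
have [v|v|e' [de' e'A]] := @fp_lift j.+1 _ _ (A j.+1) (phi j.+1 \- g)%R.
- by rewrite /= linearB dg subrr.
- by rewrite /= phiA -C'A gC' subr0.
(* The defect of the homotopy identity for [e] and [e'] is a cocycle that kills [C], so it is the
   differential of a map [c] killing [C]. *)
have [v|v|c [dc cC]] := @fp_lift j _ _ C (phi j \- (dK j \o e) \- (e' \o D j))%R.
- rewrite /= !linearB ddK subr0 de' /= -C'D gC' subr0 C'D phiD.
  exact: subrr.
- rewrite /= phiC subrr sub0r; have [u ->] := DC v.
  by rewrite e'A oppr0.
exists (existT (stage_maps j.+1) _ (C', e')); split.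
- split=> [v|u|v|//].
  + by rewrite de' /= gC' subr0.
  + by exists (row_mx u 0).
  + rewrite C'E; have [u1 u1E] := DA (lsubmx v); have [u2 u2E] := DD (rsubmx v).
    by exists (u1 + u2); rewrite !linearD u1E u2E.
split=> [v|]; first by exists (row_mx 0 v).
exists c; split=> // v; rewrite dc /= [dK j (e v) + _]addrC.
by rewrite [_ + dK j (e v)]addrAC !subrK.
Qed.

(** The source complex has the cokernels of the [A j] as terms, and [D] is a differential modulo
    relations by [DA] and [DD]. The homotopy must therefore kill every [A j]. *)
Lemma bounded_below_null : exists h : forall j, {linear 'rV[R]_(n j) -> K j},
  (forall j v, h j (A j v) = 0) /\
  forall j v, phi j v = dK j (h j v) + h j.+1 (D j v).
Proof.
pose s0 : stage 0 := existT (stage_maps 0) _ (A 0%N, \0%R : {linear _ -> _}).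
have [|s [_ sP]] := @dependent_choice_seq stage good linked s0 _ next_stage.
  by split=> //= [v|u|v]; [rewrite phiA linear0 | exists u | exact: DA].
pose C j := (projT2 (s j)).1; pose e j := (projT2 (s j)).2.
have eP j : [/\ forall v, phi j (C j v) = dK j (e j (C j v)),
      forall u, exists v, A j u = C j v,
      forall v, exists u, D j (C j v) = A j.+1 u
    & forall v, e j (A j v) = 0].
  by rewrite /C /e; case: (sP j) => + _; case: (s j) => q [].
have cP j : (forall v, exists u, D j v = C j.+1 u) /\
  exists c : {linear 'rV[R]_(n j) -> K j},
    (forall v, c (C j v) = 0) /\
    forall v, phi j v = dK j (e j v) + dK j (c v) + e j.+1 (D j v).
  rewrite /C /e; case: (sP j) => _; case: (s j) => q []; case: (s j.+1) => q' [].
  by [].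
pose c j := sval (cid (proj2 (cP j))).
have ccP j : (forall v, c j (C j v) = 0) /\
    forall v, phi j v = dK j (e j v) + dK j (c j v) + e j.+1 (D j v).
  exact: (svalP (cid (proj2 (cP j)))).
(* Adding [c] in degree [j.+1] leaves the identity in degree [j] intact, because [c j.+1] vanishes
   on the image of [D j]. *)
exists (fun j => (e j \+ c j)%R); split=> j v /=.
  have [_ AC _ ->] := eP j; have [u ->] := AC v.
  by rewrite (proj1 (ccP j)) addr0.
have [u Du] := proj1 (cP j) v.
have -> : c j.+1 (D j v) = 0 by rewrite Du (proj1 (ccP j.+1)).
by rewrite addr0 linearD (proj2 (ccP j)).
Qed.

End BoundedBelow.

(** * Hill families and null-homotopies *)

Section Hill.
Variables (R : pzRingType) (M : lmodType R).
Implicit Types N : M -> Prop.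

(* fe_mod E / N is presented by the generators fe_gen and the relations fe_rel. *)
Record fp_ext N := FpExt {
  fe_n : nat;
  fe_m : nat;
  fe_gen : {linear 'rV[R]_fe_n -> M};
  fe_rel : {linear 'rV[R]_fe_m -> 'rV[R]_fe_n};
  fe_relP : forall v, N (fe_gen v) <-> exists u, v = fe_rel u
}.

Definition fe_mod N (E : fp_ext N) (x : M) : Prop :=
  exists y v, N y /\ x = y + fe_gen E v.

Lemma fe_mod_sub N (E : fp_ext N) x : N x -> fe_mod E x.
Proof. by move=> Nx; exists x, 0; rewrite linear0 addr0. Qed.

Lemma fp_ext_refl N : submodule N -> exists E : fp_ext N, fe_mod E = N.
Proof.
move=> [N0 Nl].
pose z : {linear 'rV[R]_0 -> M} := \0%R; pose r : {linear 'rV[R]_0 -> 'rV[R]_0} := \0%R.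
have zr v : N (z v) <-> exists u, v = r u.
  by split=> // _; exists 0; apply/rowP; case.
exists (FpExt zr); apply: functional_extensionality_dep => x; apply: propext.
by split=> [[y [v [Ny ->]]]|Nx]; [rewrite addr0 | exact: fe_mod_sub].
Qed.

(** An extension of finitely presented modules is finitely presented: generators are juxtaposed, and
    the relation matrix is block triangular, with [Z] expressing [g' (A' w)] modulo [N] by the first
    generators, up to sign. *)
Lemma fp_ext_trans N (E : fp_ext N) (E' : fp_ext (fe_mod E)) :
  submodule N -> exists E'' : fp_ext N, fe_mod E'' = fe_mod E'.
Proof.
case: E E' => n m g A gA [n' m' g' A' g'A'] sN; rewrite /fe_mod /= in g'A' *.
have [u|a x y x' y' h h'||Z ZP] := @rV_choice R m' 'rV_n
    (fun w z => N (g' (A' w) + g z)).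
- have [_ h] := g'A' (A' u); have [|y [v [Ny ->]]] := h; first by exists u.
  by exists (- v); rewrite linearN addrK.
- have -> : g' (A' (a *: x + y)) + g (a *: x' + y') =
    a *: (g' (A' x) + g x') + (g' (A' y) + g y').
    by rewrite !linearP scalerDr addrACA.
  by apply: (proj2 sN).
- by rewrite !linear0 addr0; case: sN.
have [a x y|G GE] := @linear_ex R 'rV_(n + n') M
    (fun v => g (lsubmx v) + g' (rsubmx v)).
  by rewrite !linearP /= scalerDr addrACA.
have [a x y|B BE] := @linear_ex R 'rV_(m + m') 'rV_(n + n')
    (fun u => row_mx (A (lsubmx u) + Z (rsubmx u)) (A' (rsubmx u))).
  by rewrite !linearP /= scale_row_mx add_row_mx scalerDr addrACA.
have GB v : N (G v) <-> exists u, v = B u.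
  split=> [|[u ->]]; last first.
    rewrite GE BE row_mxKl row_mxKr linearD -addrA [g (Z _) + _]addrC.
    by apply: submoduleD => //; apply/gA; exists (lsubmx u).
  rewrite GE => Nv.
  have [w wE] : exists u, rsubmx v = A' u.
    apply/g'A'; exists (g (lsubmx v) + g' (rsubmx v)), (- lsubmx v); split=> //.
    by rewrite linearN addrAC subrr add0r.
  have [u uE] : exists u, lsubmx v - Z w = A u.
    apply/gA; rewrite linearB.
    have -> : g (lsubmx v) - g (Z w) =
        (g (lsubmx v) + g' (rsubmx v)) - (g' (A' w) + g (Z w)).
      by rewrite wE opprD addrA addrK.
    by apply: submoduleB.
  by exists (row_mx u w); rewrite BE row_mxKl row_mxKr -uE subrK -wE hsubmxK.
exists (FpExt GB); apply: functional_extensionality_dep => x; apply: propext.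
rewrite /=; split=> [[y [v [Ny ->]]]|[_ [v' [[y [v [Ny ->]]] ->]]]].
  exists (y + g (lsubmx v)), (rsubmx v); rewrite GE addrA; split=> //.
  by exists y, (lsubmx v).
by exists y, (row_mx v v'); rewrite GE row_mxKl row_mxKr addrA.
Qed.

(** These are the properties of the Hill lattice on which the Zorn argument rests: a starting point,
    unions of chains, and enlargement by a finitely presented piece. *)
Definition hill_family (H : (M -> Prop) -> Prop) : Prop :=
  [/\ forall N, H N -> submodule N,
      exists2 N, H N & forall x, N x -> x = 0,
      forall F : (M -> Prop) -> Prop, (exists N, F N) -> (forall N, F N -> H N) ->
        (forall N N', F N -> F N' ->
          (forall x, N x -> N' x) \/ (forall x, N' x -> N x)) ->
        H (fun x => exists2 N, F N & N x)
    & forall N x, H N -> exists E : fp_ext N, H (fe_mod E) /\ fe_mod E x].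

Lemma hill_seq H N (s : seq M) : hill_family H -> H N ->
  exists E : fp_ext N, H (fe_mod E) /\ forall x, x \in s -> fe_mod E x.
Proof.
move=> HH HN; have [sH _ _ stepH] := HH.
elim: s => [|x s [E [HE sE]]].
  by have [E EN] := fp_ext_refl (sH N HN); exists E; rewrite EN.
have [E' [HE' E'x]] := stepH _ x HE.
have [E'' E''E] := fp_ext_trans E' (sH N HN).
exists E''; rewrite E''E; split=> // y; rewrite inE => /orP[/eqP -> //|/sE Ey].
exact: fe_mod_sub.
Qed.

End Hill.

(** Enlarging a partial homotopy in degree [i] changes it on the forward orbit of [i] alone.
    Injectivity of the orbit makes the position of an index unique, so the cast value is well
    defined. *)
Lemma iter_patch (I : Type) (s : I -> I) (X : I -> Type) (W : forall k, X k)
    (i : I) (Y : forall j, X (iter j s i)) :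
  (forall j j', iter j s i = iter j' s i -> j = j') ->
  exists Z : forall k, X k, (forall j, Z (iter j s i) = Y j) /\
    forall k, (forall j, iter j s i <> k) -> Z k = W k.
Proof.
move=> s_inj.
have [Z ZP] : {Z : forall k, X k & forall k, 
    (forall j (e : iter j s i = k), Z k = ecast k (X k) e (Y j)) /\
    ((forall j, iter j s i <> k) -> Z k = W k)}.
  apply: (@all_tag I X (fun k z =>
    (forall j (e : iter j s i = k), z = ecast k (X k) e (Y j)) /\
    ((forall j, iter j s i <> k) -> z = W k))) => k; apply: cid.
  have [[j e]|nj] := pselect (exists j, iter j s i = k); last first.
    by exists (W k); split=> // j e; case: nj; exists j.
  exists (ecast k (X k) e (Y j)); split=> [j' e'|/(_ j)] //.
  have jj' : j = j' by apply: s_inj; rewrite e.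
  by case: _ / jj' e' => e'; rewrite (Prop_irrelevance e e').
exists Z; split=> [j|k nk]; first by rewrite (proj1 (ZP _) j erefl).
exact: (proj2 (ZP k)).
Qed.

(** * Null-homotopies over an abstract set of degrees with a successor, covering both integers and
    natural numbers *)

Section NullHomotopy.
Variables (R : pzRingType) (I : Type) (s : I -> I).
Hypothesis s_inj : forall i j j', iter j s i = iter j' s i -> j = j'.
Variables (M J : I -> lmodType R).
Variables (dM : forall i, {linear M i -> M (s i)}).
Variables (dJ : forall i, {linear J i -> J (s i)}).
Hypothesis ddM : forall i x, dM (s i) (dM i x) = 0.
Hypothesis ddJ : forall i x, dJ (s i) (dJ i x) = 0.
Hypothesis exJ : forall i x, dJ (s i) x = 0 -> exists y, dJ i y = x.
Hypothesis solZ : forall i, fp_solvable (ker (dJ i)).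
Hypothesis solJ : forall i, fp_solvable (J i).
Variable H : forall i, (M i -> Prop) -> Prop.
Arguments H : clear implicits.
Hypothesis HH : forall i, hill_family (H i).
Variable f : forall i, {linear M i -> J (s i)}.
Hypothesis fd : forall i x, f (s i) (dM i x) = dJ (s i) (f i x).

Let partial_homotopy (p : partial_fun M J) : Prop :=
  [/\ forall i, H i (p.1 i),
      forall i x, p.1 i x -> p.1 (s i) (dM i x),
      forall i, linear_on (p.1 i) (p.2 i)
    & forall i x, p.1 i x -> f i x = dJ i (p.2 i x) + p.2 (s i) (dM i x)].

Let H_submodule i N : H i N -> submodule N.
Proof. by case: (HH i) => + _ _ _; apply. Qed.

Section Step.
Variable p : partial_fun M J.
Hypothesis pP : partial_homotopy p.
Variables (i : I) (x0 : M i).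

Let S j := iter j s i.
Let N j := p.1 (S j).
Let h j := p.2 (S j).
Arguments N : clear implicits.
Arguments h : clear implicits.

Let sN j : submodule (N j).
Proof. by apply: H_submodule; case: pP. Qed.
Let lh j : linear_on (N j) (h j).
Proof. by case: pP => _ _ + _; apply. Qed.
Let dN j x : N j x -> N j.+1 (dM (S j) x).
Proof. by case: pP => _ + _ _; apply. Qed.
Let hN j x : N j x -> f (S j) x = dJ (S j) (h j x) + h j.+1 (dM (S j) x).
Proof. by case: pP => _ _ _; apply. Qed.

(** The next degree has to absorb only the finitely many images of basis vectors under [dM];
    linearity gives the rest. *)
Let fp_ext_seq : exists E : forall j, fp_ext (N j),
  [/\ fe_mod (E 0%N) x0, forall j, H (S j) (fe_mod (E j)) &
      forall j v, fe_mod (E j.+1) (dM (S j) (fe_gen (E j) v))].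
Proof.
have hillN j (l : seq (M (S j))) : exists E : fp_ext (N j),
    H (S j) (fe_mod E) /\ forall x, x \in l -> fe_mod E x.
  by apply: hill_seq => //; case: pP.
have [E0 [HE0 E0x]] := hillN 0%N [:: x0].
have [j E HE|E [EE0 EP]] := @dependent_choice_seq (fun j => fp_ext (N j))
    (fun j E => H (S j) (fe_mod E))
    (fun j E E' => forall v, fe_mod E' (dM (S j) (fe_gen E v))) E0 HE0.
  have [E' [HE' E'x]] := hillN j.+1
    [seq dM (S j) (fe_gen E (delta_mx 0 k)) | k <- enum 'I_(fe_n E)].
  exists E'; split=> // v; rewrite rV_linearE linear_sum.
  apply: submodule_sum => [|k _]; first exact: (H_submodule HE').
  rewrite linearZ; apply: submoduleZ; first exact: (H_submodule HE').
  by apply: E'x; apply: map_f; rewrite mem_enum.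
exists E; split=> [|j|j]; [|by case: (EP j)..].
by rewrite EE0; apply: E0x; rewrite inE.
Qed.

Lemma homotopy_step :
  exists q, [/\ partial_homotopy q, extends p q & q.1 i x0].
Proof.
have [E [E0 HE dE]] := fp_ext_seq.
pose g j := fe_gen (E j); pose A j := fe_rel (E j).
have gA j v : N j (g j v) <-> exists u, v = A j u by exact: fe_relP.
have gAu j u : N j (g j (A j u)) by apply/gA; exists u.
(* [D] expresses the differential on the new generators, modulo [N]. *)
have /all_sig[D DP] j : {D : {linear 'rV_(fe_n (E j)) -> 'rV_(fe_n (E j.+1))} |
    forall v, N j.+1 (dM (S j) (g j v) - g j.+1 (D v))}.
  apply: (@rV_choice R _ _ (fun v w => N j.+1 (dM (S j) (g j v) - g j.+1 w)))
    => [v|a v w v' w' Nv Nw|].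
  - have [y [u [Ny ->]]] := dE j v.
    by exists u; rewrite addrK.
  - have := (sN j.+1).2 a _ _ Nv Nw; congr (N _ _).
    by rewrite !linearP /= scalerBr addrACA scalerN.
  - by rewrite !linear0 addr0; case: (sN j.+1).
(* On the relations [h] is already prescribed; fp-injectivity of [J (S j)] extends these values to
   all new generators. *)
have /all_sig[e eP] j : {e : {linear 'rV_(fe_n (E j)) -> J (S j)} |
    forall u, e (A j u) = h j (g j (A j u))}.
  have [a v w|w wE] := @linear_ex R 'rV_(fe_m (E j)) (J (S j))
      (fun u => h j (g j (A j u))).
    by rewrite !linearP (lh _ (gAu j v) (gAu j w)).
  apply: cid; have [v Av|y yE] := @solJ (S j) _ _ (A j) w.
    by rewrite wE Av linear0 (linear_on0 (sN j) (@lh j)).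
  by exists y => u; rewrite yE wE.
have he j v : N j (g j v) -> h j (g j v) = e j v.
  by move=> /gA [u ->]; rewrite eP.
have NDv j v : N j (g j v) -> N j.+1 (g j.+1 (D j v)).
  move=> /dN Nv; have := submoduleB (sN j.+1) Nv (DP j v).
  by rewrite subKr.
have NDD j v : N j.+2 (g j.+2 (D j.+1 (D j v))).
  have Nz : N j.+2 (dM (S j.+1) (g j.+1 (D j v))).
    have /= := dN (DP j v).
    rewrite linearB ddM sub0r => /(submoduleN (sN j.+2)).
    by rewrite opprK.
  by have := submoduleB (sN j.+2) Nz (DP j.+1 (D j v)); rewrite subKr.
have /all_sig[hw hwE] j : {hw : {linear 'rV_(fe_n (E j)) -> J (S j.+1)} |
    forall v, hw v = h j.+1 (dM (S j) (g j v) - g j.+1 (D j v))}.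
  apply: linear_ex => a v w; rewrite -(lh _ (DP j v) (DP j w)); congr (h _ _).
  by rewrite !linearP /= scalerBr addrACA scalerN.
(* The error of the tentative homotopy: the value on [dM (g v)] is computed by [h] on the part in
   [N] and by [e] on [D v]. *)
pose phi j : {linear 'rV_(fe_n (E j)) -> J (S j.+1)} :=
  ((f (S j) \o g j) \- (dJ (S j) \o e j) \- (hw j \+ (e j.+1 \o D j)))%R.
have phiE j v : phi j v = f (S j) (g j v) - dJ (S j) (e j v) -
    (h j.+1 (dM (S j) (g j v) - g j.+1 (D j v)) + e j.+1 (D j v)).
  by rewrite -hwE.
have phiA j u : phi j (A j u) = 0.
  have Ng := gAu j u; have NgD := NDv _ _ Ng.
  rewrite phiE -(he _ _ Ng) -(he _ _ NgD) (linear_onB (sN j.+1) (@lh j.+1)) //.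
    by rewrite subrK (hN Ng) addrAC addrK subrr.
  exact: dN.
have phiD j v : phi j.+1 (D j v) = dJ (S j.+1) (phi j v).
  pose n := dM (S j) (g j v) - g j.+1 (D j v).
  have Nn : N j.+1 n := DP j v.
  have zE : g j.+1 (D j v) = dM (S j) (g j v) - n by rewrite subKr.
  have dzE : dM (S j.+1) (g j.+1 (D j v)) = - dM (S j.+1) n.
    by rewrite zE linearB ddM sub0r.
  have Nd := dN Nn; have Nd' := submoduleN (sN j.+2) Nd.
  have lhB := linear_onB (sN j.+2) (@lh j.+2).
  have lhN := linear_onN (sN j.+2) (@lh j.+2).
  rewrite (phiE j.+1) dzE lhB // -(he j.+2) // subrK lhN // opprK {1}zE.
  have -> : f (S j.+1) (dM (S j) (g j v) - n) =
      dJ (S j.+1) (f (S j) (g j v)) - (dJ (S j.+1) (h j.+1 n) + h j.+2 (dM (S j.+1) n)).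
    by rewrite linearB -(hN Nn) fd.
  have -> : dJ (S j.+1) (phi j v) = dJ (S j.+1) (f (S j) (g j v)) -
      (dJ (S j.+1) (h j.+1 n) + dJ (S j.+1) (e j.+1 (D j v))).
    by rewrite phiE linearB linearB ddJ subr0 [X in _ - X]linearD.
  by rewrite !opprD !addrA [_ - dJ _ (e _ _) + _]addrAC subrK.
have DA j u : exists u', D j (A j u) = A j.+1 u'.
  by apply/gA/NDv/gAu.
have DD j v : exists u', D j.+1 (D j v) = A j.+2 u'.
  exact/gA/NDD.
have [c [cA cE]] := bounded_below_null (fun j => @ddJ (S j)) (fun j => @exJ (S j))
  (fun j => @solZ (S j)) DA DD phiA phiD.
(* [e + c] agrees with [h] on the overlap because [c] kills the relations. *)
have /all_sig[h' h'E] j : {h' : M (S j) -> J (S j) |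
    forall y v, N j y -> h' (y + g j v) = h j y + (e j \+ c j)%R v}.
  apply: cid; apply: linear_on_glue => // v Nv.
  by rewrite /= he //; have /gA [u ->] := Nv; rewrite cA addr0.
have h'N j y : N j y -> h' j y = h j y.
  by move=> Ny; have := h'E j y 0 Ny; rewrite !linear0 !addr0.
have [Z [ZS Zn]] := @iter_patch I s (fun k => (M k -> Prop) * (M k -> J k))%type
  (fun k => (p.1 k, p.2 k)) i (fun j => (fe_mod (E j), h' j)) (@s_inj i).
pose q : partial_fun M J := (fun k => (Z k).1, fun k => (Z k).2).
have q1S j : q.1 (S j) = fe_mod (E j) by rewrite /q /= ZS.
have q2S j : q.2 (S j) = h' j by rewrite /q /= ZS.
have qn k : ~ (exists j, S j = k) -> q.1 k = p.1 k /\ q.2 k = p.2 k.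
  by move=> nk; rewrite /q /= Zn // => j jk; apply: nk; exists j.
have pq : extends p q.
  move=> k x px; have [[j jk]|nj] := pselect (exists j, S j = k).
    case: _ / jk x px => x px; rewrite q1S q2S.
    by split; [exact: fe_mod_sub | exact: h'N].
  by have [-> ->] := qn k nj.
exists q; split=> //; last by rewrite (q1S 0%N).
split=> k.
- have [[j jk]|nj] := pselect (exists j, S j = k); first by case: _ / jk; rewrite q1S.
  have [-> _] := qn k nj.
  by case: pP.
- have [[j jk]|nj] := pselect (exists j, S j = k); last first.
    have [-> _] := qn k nj; move=> x px.
    by have [_ d _ _] := pP; case: (pq _ _ (d _ _ px)).
  case: _ / jk => x; rewrite q1S => -[y [v [Ny ->]]].
  rewrite (q1S j.+1) linearD.
  by apply: (submoduleD (H_submodule (HE j.+1))) => //; exact/fe_mod_sub/dN.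
- have [[j jk]|nj] := pselect (exists j, S j = k); last first.
    have [-> ->] := qn k nj.
    by case: pP => _ _ + _; apply.
  case: _ / jk => a x y; rewrite q1S q2S => -[x1 [v [Nx ->]]] [y1 [w [Ny ->]]].
  rewrite scalerDr addrACA -linearP !h'E //; last exact: (sN j).2.
  by rewrite linearP lh // scalerDr addrACA.
have [[j jk]|nj] := pselect (exists j, S j = k); last first.
  have [-> ->] := qn k nj; move=> x px.
  have [_ d _ hp] := pP.
  by case: (pq _ _ (d _ _ px)) => _ ->; exact: hp.
case: _ / jk => x; rewrite q1S (q2S j) (q2S j.+1) => -[y [v [Ny ->]]].
have -> : dM (S j) (y + g j v) = (dM (S j) y +
    (dM (S j) (g j v) - g j.+1 (D j v))) + g j.+1 (D j v).
  by rewrite linearD -addrA subrK.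
have Nd := dN Ny; have Nn := DP j v.
rewrite !h'E //; last exact: (submoduleD (sN j.+1)).
have := phiE j v; rewrite cE => /esym/eqP; rewrite !subr_eq => /eqP fE.
rewrite linearD (hN Ny) fE (linear_onD (@lh j.+1) Nd Nn) !linearD /=.
by rewrite !addrA [LHS](ACl (1*7*3*2*5*6*4)).
Qed.

End Step.

(** Zorn's lemma is applied to homotopies on subcomplexes with terms in the [H i], starting from the
    zero members; [homotopy_step] provides the enlargement. *)
Theorem hill_null_homotopic : exists h : forall i, {linear M i -> J i},
  forall i x, f i x = dJ i (h i x) + h (s i) (dM i x).
Proof.
have /all_sig[N0 N0P] i : {N0 | H i N0 /\ forall x, N0 x -> x = 0}.
  by apply: cid; have [_ [N HN N0] _ _] := HH i; exists N.
have N00 i : N0 i 0 by have [/H_submodule[]] := N0P i.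
have [|A h [p Ap] AP Atot hE|p i x pP _|h [_ _ lh hP]] :=
    @zorn_extension I M J partial_homotopy (N0, fun _ _ => 0).
- split=> [i|i x /(proj2 (N0P i)) ->|i a x y _ _|i x /(proj2 (N0P i)) ->] /=.
  + by case: (N0P i).
  + by rewrite linear0.
  + by rewrite scaler0 addr0.
  + by rewrite !linear0 addr0.
- split=> [i|i x [q Aq qx]|i a x y [q Aq qx] [r Ar ry]|i x [q Aq qx]] /=.
  + have [sH _ cH _] := HH i.
    pose F N := exists2 q, A q & q.1 i = N.
    have -> : (fun x => exists2 q, A q & q.1 i x) = (fun x => exists2 N, F N & N x).
      apply: functional_extensionality_dep => x; apply: propext.
      split=> [[q Aq qx]|[_ [q Aq <-] qx]]; last by exists q.
      by exists (q.1 i) => //; exists q.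
    apply: cH => [|_ [q Aq <-]|_ _ [q Aq <-] [r Ar <-]].
    * by exists (p.1 i), p.
    * by case: (AP q Aq).
    * by have [qr|rq] := Atot q r Aq Ar; [left => x /qr | right => x /rq] => -[].
  + by exists q => //; case: (AP q Aq) => _ + _ _; apply.
  + have [w [Aw wx wy]] : exists w, [/\ A w, w.1 i x & w.1 i y].
      have [qr|rq] := Atot q r Aq Ar; [exists r | exists q]; split=> //.
        by case: (qr i x qx).
      by case: (rq i y ry).
    have [Hw _ lw _] := AP w Aw.
    by rewrite !(hE w) //; [exact: lw | exact: (H_submodule (Hw i)).2].
  + rewrite (hE q) // (hE q) //; last by case: (AP q Aq) => _ + _ _; apply.
    by case: (AP q Aq) => _ _ _; apply.
- exact: homotopy_step.
have /all_sig[g gE] i : {g : {linear M i -> J i} | g =1 h i}.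
  by apply: linear_ex => a x y; apply: lh.
by exists g => i x; rewrite !gE; exact: hP.
Qed.

End NullHomotopy.

(** * Cellular modules *)

Section Cells.
Variables (R : pzRingType) (P : lmodType R).

(* A cell adjoins k generators, mapped to P by lab, and m relations saying that
   the combinations of these generators given by the rows of A equal certain
   combinations, given by B, of generators of the earlier cells sub e. *)
Inductive cell : Type := Cell (k m l : nat)
  (lab : {linear 'rV[R]_k -> P})
  (A : 'M[R]_(m, k))
  (sub : 'I_l -> cell)
  (B : 'I_l -> 'I_m -> nat -> R).

Definition cell_gens (c : cell) := let: @Cell k _ _ _ _ _ _ := c in k.
Definition cell_rels (c : cell) := let: @Cell _ m _ _ _ _ _ := c in m.
Definition cell_arity (c : cell) := let: @Cell _ _ l _ _ _ _ := c in l.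
Definition cell_lab (c : cell) : {linear 'rV[R]_(cell_gens c) -> P} :=
  let: @Cell _ _ _ lab _ _ _ := c in lab.
Definition cell_mx (c : cell) : 'M[R]_(cell_rels c, cell_gens c) :=
  let: @Cell _ _ _ _ A _ _ := c in A.
Definition cell_sub (c : cell) : 'I_(cell_arity c) -> cell :=
  let: @Cell _ _ _ _ _ sub _ := c in sub.
Definition cell_coef (c : cell) : 'I_(cell_arity c) -> 'I_(cell_rels c) -> nat -> R :=
  let: @Cell _ _ _ _ _ _ B := c in B.

Fixpoint cell_rank (c : cell) : nat :=
  let: @Cell _ _ _ _ _ sub _ := c in \max_e (cell_rank (sub e)).+1.

Arguments cell_sub : clear implicits.
Arguments cell_coef : clear implicits.

Lemma cell_rank_sub c e : (cell_rank (cell_sub c e) < cell_rank c)%N.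
Proof.
case: c e => k m l lab A sub B e /=.
exact: (leq_bigmax (F := fun e => (cell_rank (sub e)).+1)).
Qed.

HB.instance Definition _ := gen_eqMixin cell.
HB.instance Definition _ := gen_choiceMixin cell.

Definition gens_mod : lmodType R :=
  @dirsum R cell (fun c => 'rV[R]_(cell_gens c) : lmodType R).
Definition rels_mod : lmodType R :=
  @dirsum R cell (fun c => 'rV[R]_(cell_rels c) : lmodType R).

Definition cgen c : {linear 'rV[R]_(cell_gens c) -> gens_mod} :=
  @ds_inl R cell (fun c => 'rV[R]_(cell_gens c) : lmodType R) c.
Definition crel c : {linear 'rV[R]_(cell_rels c) -> rels_mod} :=
  @ds_inl R cell (fun c => 'rV[R]_(cell_rels c) : lmodType R) c.

Lemma cgen_eq c (v : 'rV_(cell_gens c)) : cgen c v c = v.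
Proof. exact: ds_in_eq. Qed.

Lemma cgen_neq c c' (v : 'rV_(cell_gens c)) : c != c' -> cgen c v c' = 0.
Proof. exact: ds_in_neq. Qed.

Lemma crel_eq c (v : 'rV_(cell_rels c)) : crel c v c = v.
Proof. exact: ds_in_eq. Qed.

Lemma crel_neq c c' (v : 'rV_(cell_rels c)) : c != c' -> crel c v c' = 0.
Proof. exact: ds_in_neq. Qed.

Fact cell_val_linear c : linear (fun v : 'rV[R]_(cell_rels c) =>
  \sum_e cgen (cell_sub c e) (v *m \matrix_(i, j) cell_coef c e i j)).
Proof.
move=> a x y; rewrite scaler_sumr -big_split /=; apply: eq_bigr => e _.
by rewrite -linearP mulmxDl -scalemxAl.
Qed.

Definition cell_val c : {linear 'rV[R]_(cell_rels c) -> gens_mod} :=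
  sval (linear_ex (@cell_val_linear c)).

Lemma cell_valE c v :
  cell_val c v = \sum_e cgen (cell_sub c e) (v *m \matrix_(i, j) cell_coef c e i j).
Proof. exact: (svalP (linear_ex (@cell_val_linear c))). Qed.

Definition lab : {linear gens_mod -> P} := sval (ds_linear cell_lab).

Lemma lab_gen c v : lab (cgen c v) = cell_lab c v.
Proof. exact: (svalP (ds_linear cell_lab)). Qed.

Definition lhs_map : {linear rels_mod -> gens_mod} :=
  sval (ds_linear (fun c => (cgen c \o mulmxr (cell_mx c))%FUN)).

Definition rhs_map : {linear rels_mod -> gens_mod} := sval (ds_linear cell_val).

Lemma lhs_rel c v : lhs_map (crel c v) = cgen c (v *m cell_mx c).
Proof. exact: (svalP (ds_linear (fun c => (cgen c \o mulmxr (cell_mx c))%FUN))). Qed.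

Lemma rhs_rel c v : rhs_map (crel c v) = cell_val c v.
Proof. exact: (svalP (ds_linear cell_val)). Qed.

Definition rel_map : {linear rels_mod -> gens_mod} := (lhs_map \- rhs_map)%R.

Lemma rel_mapE V : rel_map V = lhs_map V - rhs_map V. Proof. by []. Qed.

Lemma lhs_mapE V c : lhs_map V c = V c *m cell_mx c.
Proof.
apply: (@ds_submodule R cell (fun c => 'rV[R]_(cell_rels c) : lmodType R)
  (fun V => lhs_map V c = V c *m cell_mx c)) => [|c'].
  split=> [|a x y hx hy]; first by rewrite linear0 mul0mx.
  by rewrite linearP dsD dsZ hx hy mulmxDl -scalemxAl.
rewrite -[ds_in _]/(crel c' (V c')) lhs_rel.
have [cc|cc] := eqVneq c' c; first by case: _ / cc; rewrite cgen_eq crel_eq.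
by rewrite cgen_neq // crel_neq // mul0mx.
Qed.

Lemma supported_cell_val (S : cell -> Prop) c v :
  (forall e, S (cell_sub c e)) -> supported S (cell_val c v).
Proof.
move=> Ssub; rewrite cell_valE; apply: submodule_sum => [|e _].
  exact: supported_submodule.
exact: supported_in.
Qed.

Lemma supported_rhs (S : cell -> Prop) (V : rels_mod) :
  (forall c, V c <> 0 -> forall e, S (cell_sub c e)) -> supported S (rhs_map V).
Proof.
move=> SV; apply: ds_submodule_preim => [|c Vc]; first exact: supported_submodule.
by rewrite rhs_rel; apply: supported_cell_val; exact: SV.
Qed.

Lemma supported_lhs (S : cell -> Prop) (V : rels_mod) :
  supported S V -> supported S (lhs_map V).
Proof.
by move=> SV c Vc; apply: SV => V0; apply: Vc; rewrite lhs_mapE V0 mul0mx.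
Qed.

(** The first condition lets [lab] descend to the quotient. The second is consistency: a combination
    of relations with zero left-hand side has a right-hand side already in [N], so that the cell
    forces nothing new on earlier ones. *)
Definition valid_at (N : gens_mod -> Prop) (c : cell) : Prop :=
  (forall v, lab (rel_map (crel c v)) = 0) /\
  (forall v, v *m cell_mx c = 0 -> N (cell_val c v)).

(* A cell whose relations are inconsistent over the cells of smaller rank, or do
   not map to 0 in P, contributes free generators and no relation: this keeps
   the inductive type cell free of proof obligations. *)
Fixpoint null (n : nat) (x : gens_mod) : Prop :=
  if n is k.+1 then exists V : rels_mod,
    (forall c, V c <> 0 -> cell_rank c = k /\ valid_at (null k) c) /\
    null k (x - rel_map V)
  else x = 0.

Definition valid (c : cell) : Prop := valid_at (null (cell_rank c)) c.

Lemma nullS k x : null k.+1 x <-> exists V : rels_mod,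
    (forall c, V c <> 0 -> cell_rank c = k /\ valid c) /\ null k (x - rel_map V).
Proof.
split=> -[V [VP nx]]; exists V; split=> // c /VP [rc vc]; split=> //.
  by rewrite /valid rc.
by rewrite -rc.
Qed.

Lemma null_submodule n : submodule (null n).
Proof.
elim: n => [|n [IH0 IHl]].
  by split=> //= a x y -> ->; rewrite scaler0 addr0.
split=> [|a x y]; first by exists 0; split=> [c []//|]; rewrite linear0 subr0.
move=> [V [VP nx]] [W [WP ny]]; exists (a *: V + W); split=> [c VWc|].
  have [V0|/VP //] := pselect (V c = 0); apply: WP => W0; apply: VWc.
  by rewrite dsD dsZ V0 W0 scaler0 addr0.
by rewrite linearP opprD addrACA -scalerBr; exact: IHl.
Qed.

Lemma null_leq m n x : (m <= n)%N -> null m x -> null n x.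
Proof.
move=> /subnK <-; elim: (n - m)%N => // k IH /IH nx; rewrite addSn; exists 0.
by split=> [c []//|]; rewrite linear0 subr0.
Qed.

Lemma null_supported n x : null n x -> supported (fun c => (cell_rank c < n)%N) x.
Proof.
elim: n x => [|n IH] x; first by move=> -> c [].
case=> V [VP /IH nx]; rewrite -(subrK (rel_map V) x).
have sS := @supported_submodule R cell (fun c => 'rV[R]_(cell_gens c) : lmodType R)
  (fun c => (cell_rank c < n.+1)%N).
apply: (submoduleD sS) => [c /nx /leqW //|]; apply: (submoduleB sS).
  by apply: supported_lhs => c /VP [->].
by apply: supported_rhs => c /VP [<- _] e; rewrite ltnS ltnW // cell_rank_sub.
Qed.

Fact restrict_fin (S : cell -> Prop) (V : rels_mod) : exists s : seq cell,
  forall c, c \notin s -> (if `[< S c >] then V c else 0) = 0.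
Proof. by case: (ds_fin V) => s Vs; exists s => c /Vs ->; rewrite if_same. Qed.

Definition restrict S (V : rels_mod) : rels_mod := DirSum (restrict_fin S V).

Lemma restrictT S V c : S c -> restrict S V c = V c.
Proof. by move=> /asboolT /= ->. Qed.

Lemma restrictF S V c : ~ S c -> restrict S V c = 0.
Proof. by move=> /asboolF /= ->. Qed.

Lemma restrict_neq0 S V c : restrict S V c <> 0 -> S c /\ V c <> 0.
Proof.
have [Sc|Sc] := pselect (S c); first by rewrite restrictT.
by rewrite restrictF // => /(_ erefl).
Qed.

Lemma restrict_sub S V c : (V - restrict S V) c <> 0 -> ~ S c /\ V c <> 0.
Proof.
rewrite dsB; have [Sc|Sc] := pselect (S c).
  by rewrite restrictT // subrr => /(_ erefl).
by rewrite restrictF // subr0.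
Qed.

Lemma null_rel_map n (V : rels_mod) :
  (forall c, V c <> 0 -> (cell_rank c < n)%N /\ valid c) -> null n (rel_map V).
Proof.
elim: n V => [|n IH] V VP.
  have -> : V = 0 by apply: dirsumP => c; apply: contrapT => /VP [].
  exact: linear0.
apply/nullS; exists (restrict (fun c => cell_rank c = n) V); split.
  by move=> c Vc; have [/= rc /VP []] := restrict_neq0 Vc.
rewrite -linearB; apply: IH => c Vc.
have [/= rc /VP [rn vc]] := restrict_sub Vc; split=> //.
by rewrite ltn_neqAle -ltnS rn andbT; exact/eqP.
Qed.

Definition sub_closed (S : cell -> Prop) : Prop := forall c e, S c -> S (cell_sub c e).

(** Relations of cells outside [S] can be eliminated from the top rank downwards: they must cancel
    on the left, and then validity makes their right-hand sides null at a lower rank. *)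
Lemma null_sub_closed n (S : cell -> Prop) x :
  sub_closed S -> supported S x -> null n x ->
  exists V : rels_mod, (forall c, V c <> 0 -> S c /\ valid c) /\ x = rel_map V.
Proof.
move=> clS; elim: n x => [|n IH] x Sx.
  by move=> ->; exists 0; split=> [c []//|]; rewrite linear0.
move=> /nullS [V [VP nx]].
pose V1 := restrict S V; pose V2 := V - V1.
have V2P c : V2 c <> 0 -> [/\ ~ S c, cell_rank c = n & valid c].
  by move=> V2c; have [nSc /VP []] := restrict_sub V2c.
(* The coordinate at a cell [c] of rank [n] outside [S] is compared: [x], the remainder and all
   right-hand sides vanish there, so the left-hand side does too. *)
have V2A c : V2 c *m cell_mx c = 0.
  have [-> | V2c] := pselect (V2 c = 0); first by rewrite mul0mx.
  have [nSc rc _] := V2P c V2c.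
  have V2E : V2 c = V c by rewrite /V2 dsB restrictF // subr0.
  have x0 : x c = 0 by apply: contrapT => /Sx.
  have xV0 : (x - rel_map V) c = 0.
    by apply: contrapT => /(null_supported nx); rewrite rc ltnn.
  have V0 : rhs_map V c = 0.
    apply: contrapT => Vc.
    have SV c' : V c' <> 0 -> forall e, (cell_rank (cell_sub c' e) < n)%N.
      by move=> /VP [<- _] e; exact: cell_rank_sub.
    have := @supported_rhs (fun c' => (cell_rank c' < n)%N) V SV c Vc.
    by rewrite rc ltnn.
  move: xV0; rewrite dsB x0 sub0r rel_mapE dsB V0 subr0 lhs_mapE V2E => /eqP.
  by rewrite oppr_eq0 => /eqP.
(* Only right-hand sides are left in [rel_map V2], and consistency of valid cells makes them
   null. *)
have nV2 : null n (rel_map V2).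
  rewrite rel_mapE; have -> : lhs_map V2 = 0.
    by apply: dirsumP => c; rewrite lhs_mapE V2A.
  rewrite sub0r; apply: (submoduleN (null_submodule n)).
  apply: ds_submodule_preim (null_submodule n) _ => c V2c.
  rewrite rhs_rel; have [_ <- [_ vc]] := V2P c V2c; apply: vc; exact: V2A.
have V1P c : V1 c <> 0 -> S c /\ valid c.
  by move=> V1c; have [Sc /VP []] := restrict_neq0 V1c.
have sS := @supported_submodule R cell (fun c => 'rV[R]_(cell_gens c) : lmodType R) S.
have Sx1 : supported S (x - rel_map V1).
  apply: (submoduleB sS) => //; apply: (submoduleB sS).
    by apply: supported_lhs => c /V1P [].
  by apply: supported_rhs => c /V1P [Sc _] e; exact: clS.
have nx1 : null n (x - rel_map V1).
  have -> : x - rel_map V1 = x - rel_map V + rel_map V2.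
    have -> : rel_map V2 = rel_map V - rel_map V1 by exact: linearB.
    by rewrite addrA subrK.
  exact: (submoduleD (null_submodule n)).
have [W [WP xE]] := IH _ Sx1 nx1.
exists (W + V1); split=> [c|]; last by rewrite linearD -xE subrK.
have [W0|/WP //] := pselect (W c = 0).
by rewrite dsD W0 add0r => /V1P.
Qed.

Definition null_all (x : gens_mod) : Prop := exists n, null n x.

Lemma null_all_submodule : submodule null_all.
Proof.
split=> [|a x y [m nx] [n ny]]; first by exists 0%N.
exists (maxn m n); apply: (null_submodule _).2.
  exact: null_leq (leq_maxl m n) nx.
exact: null_leq (leq_maxr m n) ny.
Qed.

(** Cells of rank below [n] form a sub-closed set, so cells of higher rank impose no further
    relation on their generators. *)
Lemma null_all_rank n x :
  supported (fun c => (cell_rank c < n)%N) x -> null_all x -> null n x.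
Proof.
move=> Sx [k nx]; have [|V [VP ->]] := null_sub_closed _ Sx nx.
  by move=> c e; exact/ltn_trans/cell_rank_sub.
exact: null_rel_map.
Qed.

Lemma null_all_rel_map (V : rels_mod) :
  (forall c, V c <> 0 -> valid c) -> null_all (rel_map V).
Proof.
move=> VP; case: (ds_fin V) => s Vs; exists (\max_(c <- s) (cell_rank c).+1)%N.
apply: null_rel_map => c Vc; split; last exact: VP.
have cs : c \in s by apply: contraT => /Vs.
by rewrite (big_rem c) //= leq_max ltnSn.
Qed.

Lemma lab_null n x : null n x -> lab x = 0.
Proof.
elim: n x => [|n IH] x /=; first by move=> ->; rewrite linear0.
case=> V [VP /IH/eqP]; rewrite linearB subr_eq0 => /eqP ->.
pose U (y : P) := y = 0.
have sU : submodule U by split=> // a y z -> ->; rewrite scaler0 addr0.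
apply: (@ds_submodule_preim _ _ _ _ (lab \o rel_map)%FUN U V sU) => c /VP [_ [+ _]].
exact.
Qed.

End Cells.
Arguments cell_sub {R P} c e.

(** * The cellular module over [P], its Hill family, and the kernel of its projection *)

Section CellularModule.
Variables (R : pzRingType) (P M : lmodType R).
Local Notation cell := (cell P).
Local Notation gens_mod := (gens_mod P).
Variable pi : {linear gens_mod -> M}.
Hypothesis pi_surj : surjective pi.
Hypothesis kpi : forall x, pi x = 0 <-> null_all x.

Definition cell_span (S : cell -> Prop) (z : M) : Prop :=
  exists x : gens_mod, supported S x /\ pi x = z.

Let supp_sub S := @supported_submodule R cell
  (fun c => 'rV[R]_(cell_gens c) : lmodType R) S.

Lemma cell_span_submodule S : submodule (cell_span S).
Proof.
split=> [|a _ _ [x [Sx <-]] [y [Sy <-]]].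
  by exists 0; rewrite linear0; split=> //; case: (supp_sub S).
by exists (a *: x + y); rewrite linearP; split=> //; exact: (supp_sub S).2.
Qed.

Lemma cell_span_mono (S S' : cell -> Prop) z :
  (forall c, S c -> S' c) -> cell_span S z -> cell_span S' z.
Proof. by move=> SS' [x [Sx <-]]; exists x; split=> // c /Sx /SS'. Qed.

Lemma cell_span_gen (S : cell -> Prop) c v : S c -> cell_span S (pi (cgen c v)).
Proof. by move=> Sc; exists (cgen c v); split=> //; exact: supported_in. Qed.

Lemma pi_relation c v : valid c -> pi (cgen c (v *m cell_mx c)) = pi (cell_val c v).
Proof.
move=> vc; apply/eqP; rewrite -subr_eq0 -linearB; apply/eqP/kpi.
rewrite -lhs_rel -rhs_rel; apply: null_all_rel_map => c' vc'.
by have [<- //|cc'] := eqVneq c c'; case: vc'; rewrite crel_neq.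
Qed.

(** By [null_sub_closed], a relation on the new generators modulo the span of [S] comes from valid
    cells in [S] or from [c]. No right-hand side involves [c], so the coordinate at [c] is a
    combination of rows of [cell_mx c]. The quotient is thus presented by this matrix, or free if
    [c] is not valid. *)
Lemma add_one_cell (S : cell -> Prop) c :
  sub_closed S -> (forall e, S (cell_sub c e)) -> ~ S c ->
  exists E : fp_ext (cell_span S),
    fe_mod E = cell_span (fun c' => S c' \/ c' = c).
Proof.
move=> clS Ssub nSc; pose S' c' := S c' \/ c' = c.
have clS' : sub_closed S'.
  by move=> c' e [/clS Sc'|c'E]; left=> //; case: _ / (esym c'E) e.
pose m := if `[< valid c >] then cell_rels c else 0%N.
have [A AE] : exists A : {linear 'rV[R]_m -> 'rV[R]_(cell_gens c)},
    forall v, (exists u, v = A u) <-> exists2 w, v = w *m cell_mx c & valid c \/ w = 0.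
  rewrite /m; have [vc|nvc] := pselect (valid c).
    rewrite asboolT //; exists (mulmxr (cell_mx c)) => v; split=> -[w ->].
      by exists w => //; left.
    by move=> _; exists w.
  rewrite asboolF //; exists \0%R => v; split=> [[u ->]|[w -> [//|->]]].
    by exists 0; [rewrite mul0mx | right].
  by exists 0; rewrite mul0mx.
have gA v : cell_span S ((pi \o cgen c)%FUN v) <-> exists u, v = A u.
  rewrite AE; split=> [[x [Sx /= xE]]|[w -> [vc|->]]]; last 2 first.
  - exists (cell_val c w); split; first exact: supported_cell_val.
    by rewrite -pi_relation.
  - by rewrite mul0mx linear0; case: (cell_span_submodule S).
  have [n nx] : null_all (cgen c v - x) by apply/kpi; rewrite linearB xE subrr.
  have Sx' : supported S' (cgen c v - x).
    apply: (submoduleB (supp_sub S')); first by apply: supported_in; right.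
    by move=> c' /Sx; left.
  have [V [VP vE]] := null_sub_closed clS' Sx' nx.
  have xc : x c = 0 by apply: contrapT => /Sx.
  have rVc : rhs_map P V c = 0.
    apply: contrapT => Vc; apply: nSc.
    apply: (@supported_rhs R P S V _ c Vc) => c' /VP [[Sc'|c'E] _] e.
      exact: clS.
    by case: _ / (esym c'E) e.
  have := congr1 (fun x : gens_mod => x c) vE.
  rewrite dsB cgen_eq xc subr0 rel_mapE dsB rVc subr0 lhs_mapE => ->.
  exists (V c) => //; have [->|/VP [_ vc]] := pselect (V c = 0); [by right | by left].
exists (FpExt gA); apply: functional_extensionality_dep => z; apply: propext.
split=> [[y [v [Sy ->]]]|[x [Sx <-]]].
  apply: (submoduleD (cell_span_submodule S')).
    by apply: cell_span_mono Sy => c'; left.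
  by apply: cell_span_gen; right.
exists (pi (x - cgen c (x c))), (x c); split=> /=; last by rewrite linearB subrK.
exists (x - cgen c (x c)); split=> // c'.
have [<-|cc'] := eqVneq c c'; first by rewrite dsB cgen_eq subrr => /(_ erefl).
by rewrite dsB cgen_neq // subr0 => /Sx [//|/eqP]; rewrite eq_sym (negPf cc').
Qed.

Definition cell_ext (S S' : cell -> Prop) : Prop :=
  [/\ sub_closed S', forall c, S c -> S' c &
      exists E : fp_ext (cell_span S), fe_mod E = cell_span S'].

Lemma cell_ext_trans S S' S'' : cell_ext S S' -> cell_ext S' S'' -> cell_ext S S''.
Proof.
move=> [_ SS' [E EE]] [cl S'S'' [E' E'E]]; split=> // [c /SS' /S'S''//|].
case: _ / EE E' E'E => E' E'E.
have [E'' E''E] := fp_ext_trans E' (cell_span_submodule S).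
by exists E''; rewrite E''E.
Qed.

Lemma cell_ext_refl S : sub_closed S -> cell_ext S S.
Proof. by move=> clS; split=> //; exact/fp_ext_refl/cell_span_submodule. Qed.

Lemma add_cells (l : seq cell) :
  (forall c, c \in l -> forall S, sub_closed S -> exists2 S', cell_ext S S' & S' c) ->
  forall S, sub_closed S -> exists2 S', cell_ext S S' & forall c, c \in l -> S' c.
Proof.
elim: l => [_ S clS|c l IH lP S clS].
  by exists S => //; exact: cell_ext_refl.
have [S' SS' S'c] := lP c (mem_head c l) S clS.
have clS' : sub_closed S' by case: SS'.
have [|S'' S'S'' S''l] := IH _ S' clS'.
  by move=> c' c'l; apply: lP; rewrite inE c'l orbT.
exists S''; first exact: cell_ext_trans S'S''.
by move=> c'; rewrite inE => /orP[/eqP -> |/S''l //]; case: S'S'' => _ + _; apply.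
Qed.

(** By induction on the rank, the finitely many subcells are added before the cell itself, so every
    cell has a finite closure. *)
Lemma add_cell (c : cell) S : sub_closed S -> exists2 S', cell_ext S S' & S' c.
Proof.
have [n] := ubnP (cell_rank c); elim: n c S => // n IH c S rc clS.
have [c' c's S0 clS0|S' SS' S'sub] :=
    @add_cells [seq cell_sub c e | e <- enum 'I_(cell_arity c)] _ S clS.
  have /mapP[e _ ->] := c's; apply: IH => //.
  exact: leq_trans (cell_rank_sub e) rc.
have clS' : sub_closed S' by case: SS'.
have S'e e : S' (cell_sub c e) by apply: S'sub; apply: map_f; rewrite mem_enum.
have [S'c|nS'c] := pselect (S' c); first by exists S'.
exists (fun c' => S' c' \/ c' = c); last by right.
apply: cell_ext_trans SS' _; split=> [c' e [/clS' S'c'|c'E]|c'|].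
- by left.
- by left; case: _ / (esym c'E) e.
- by left.
- exact: add_one_cell.
Qed.

Definition cell_hill (N : M -> Prop) : Prop :=
  exists2 S, sub_closed S & N = cell_span S.

Lemma cell_hill_family : hill_family cell_hill.
Proof.
split=> [_ [S _ ->]||F [N0 FN0] FH Ftot|_ z [S clS ->]].
- exact: cell_span_submodule.
- exists (cell_span (fun _ => False)); first by exists (fun _ => False).
  move=> _ [x [x0 <-]]; have -> : x = 0 by apply: dirsumP => c; apply: contrapT => /x0.
  exact: linear0.
(* A member of [F] may be the span of several cell sets; taking all sub-closed ones avoids a choice,
   and [F] being a chain makes the union a submodule. *)
- exists (fun c => exists S, [/\ sub_closed S, F (cell_span S) & S c]).
    by move=> c e [S [clS FS Sc]]; exists S; split=> //; exact: clS.
  apply: functional_extensionality_dep => z; apply: propext.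
  split=> [[N FN]|[x [xS <-]]].
    have [S clS NE] := FH N FN; rewrite NE => -[x [Sx <-]].
    exists x; split=> // c /Sx Sc.
    by exists S; split=> //; rewrite -NE.
  have sub N : F N -> submodule N by move=> /FH [S _ ->]; exact: cell_span_submodule.
  have sU : submodule (fun z => exists2 N, F N & N z).
    split=> [|a x1 y [N FN Nx] [N' FN' N'y]].
      by exists N0 => //; case: (sub _ FN0).
    have [NN'|N'N] := Ftot _ _ FN FN'.
      by exists N' => //; apply: (sub _ FN').2 => //; exact: NN'.
    by exists N => //; apply: (sub _ FN).2 => //; exact: N'N.
  apply: (ds_submodule_preim (f := pi)) sU _ => c /xS [S [clS FS Sc]].
  by exists (cell_span S) => //; exact: cell_span_gen.
have [x <-] := pi_surj z; have [s xs] := ds_fin x.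
have [|S' [clS' SS' [E EE]] sS'] := @add_cells s _ S clS.
  by move=> c _ S0; exact: add_cell.
exists E; rewrite EE; split; first by exists S'.
exists x; split=> // c xc; apply: sS'; apply: contraT => cs.
by case: xc; exact: xs.
Qed.

Variable p : {linear M -> P}.
Hypothesis pE : forall x, p (pi x) = lab P x.

(** Every consistent finite system over the kernel is itself the relation part of a cell with labels
    0, and the generators of that cell solve it. *)
Lemma cell_ker_solvable : fp_solvable (ker p).
Proof.
move=> m n f w fw.
have [a x y|iota iE] := @linear_ex R (ker p) M (@ker_val _ _ _ p); first by [].
have /choice[u uP] i : exists u, pi u = ker_val (w (delta_mx 0 i)) by exact: pi_surj.
have /choice[s sP] i := ds_fin (u i).
pose l := undup (flatten [seq s i | i <- enum 'I_m]).
have ul i c : c \notin l -> u i c = 0.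
  rewrite mem_undup => cl; apply: sP; apply: contra cl => cs.
  by apply/flattenP; exists (s i) => //; apply: map_f; rewrite mem_enum.
pose sub (e : 'I_(size l)) := tnth (in_tuple l) e.
pose B e i j := if insub j is Some j' then u i (sub e) 0 j' else 0.
(* The rows of [f] are the left-hand sides; the right-hand sides are lifts [u] of the values of [w],
   which involve only the cells in the finite list [l]. *)
pose c := @Cell R P n m (size l) \0%R (lin1_mx f) sub B.
have uE i : u i = \sum_e cgen (sub e) (u i (sub e)).
  rewrite {1}(ds_sumE (undup_uniq _) (ul i)) big_tnth.
  by [].
have valE v : pi (cell_val c v) = ker_val (w v).
  have -> : cell_val c v = \sum_i v 0 i *: u i.
    under [RHS]eq_bigr => i _ do rewrite uE scaler_sumr.
    rewrite cell_valE exchange_big; apply: eq_bigr => e _ /=.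
    under eq_bigr => i _ do rewrite -linearZ.
    rewrite -linear_sum; congr (cgen _ _); apply/rowP => j.
    rewrite !mxE summxE; apply: eq_bigr => i _.
    by rewrite !mxE /B valK.
  rewrite linear_sum (rV_linearE w) -iE linear_sum.
  by apply: eq_bigr => i _; rewrite !linearZ /= iE uP.
have vc : valid c.
  split=> [v|v /= vA].
    rewrite rel_mapE lhs_rel rhs_rel linearB lab_gen -pE valE ker_valK.
    by rewrite subr0.
  (* Consistency: the right-hand side maps to [w v = 0], hence is null at some stage, and
     [null_all_rank] brings this down to the rank of [c]. *)
  apply: null_all_rank.
    apply: supported_cell_val => e; exact: cell_rank_sub.
  by apply/kpi; rewrite valE fw // -mul_rV_lin1.
have [v|y yE] := @linear_lift_ker R _ _ _ (pi \o cgen c)%FUN p.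
  by rewrite /= pE lab_gen.
exists y => v; apply: val_inj; rewrite /= yE /= -valE -pi_relation //=.
by rewrite mul_rV_lin1.
Qed.

End CellularModule.

(** The projection [p] from the cellular module has fp-injective kernel, so it splits by
    fp-projectivity. *)
Lemma fp_projective_retract (R : pzRingType) (P : lmodType R) :
  fp_projective P -> exists (M : lmodType R) (p : {linear M -> P})
    (s : {linear P -> M}) (H : (M -> Prop) -> Prop),
    hill_family H /\ forall x, p (s x) = x.
Proof.
move=> Pfp.
have [M [pi [pi_surj kpi]]] := quotient_ex (null_all_submodule P).
have [x /kpi [n nx]|p pE] := linear_factor pi_surj (f := lab P).
  exact: lab_null nx.
have solK := cell_ker_solvable pi_surj kpi pE.
have [a x y|i iE] := @linear_ex R (ker p) M (@ker_val _ _ _ p).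
  by [].
have [||x|s sE] := Ext1_split (i := i) (p := p) (Pfp _ (solvable_fp_injective solK)).
- by move=> x; rewrite iE => x0; apply: val_inj.
- move=> x; split=> [px|[y <-]]; last by rewrite iE ker_valK.
  have kx : x \in ker_pred p by apply/eqP.
  by exists (Ker kx); rewrite iE.
(* Surjectivity: a cell with one generator labelled [x] and no relations hits [x]. *)
- pose A : 'M[R]_(0, 1) := 0.
  have [a u v|f fE] := @linear_ex R 'rV_1 P (fun v => v 0 0 *: x).
    by rewrite !mxE scalerDl scalerA.
  pose c := @Cell R P 1 0 0 f A (fun e => False_rect _ (notF (ltn_ord e)))
    (fun _ _ _ => 0).
  exists (pi (cgen c (const_mx 1))); rewrite pE lab_gen /= fE mxE scale1r //.
exists M, p, s, (cell_hill pi); split=> //.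
exact: cell_hill_family.
Qed.

(** * Injective coresolutions *)

Definition injective_mod (R : pzRingType) (E : lmodType R) : Prop :=
  forall (A B : lmodType R) (u : {linear A -> B}) (f : {linear A -> E}),
    (forall x, u x = 0 -> f x = 0) ->
    exists g : {linear B -> E}, forall x, g (u x) = f x.

(** * Divisible abelian groups, as modules over the integers *)

Section Divisible.

Lemma int_linear (A D : lmodType int) (f : A -> D) :
  (forall x y, f (x + y) = f x + f y) -> linear f.
Proof.
move=> fD; have f0 : f 0 = 0 by apply: (addrI (f 0)); rewrite -fD !addr0.
have fN x : f (- x) = - f x by apply: (addrI (f x)); rewrite -fD !subrr.
have fn (n : nat) x : f (x *+ n) = f x *+ n.
  by elim: n => [|n IH]; rewrite ?mulr0n // !mulrS fD IH.
move=> a x y; rewrite fD; congr (_ + _).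
rewrite -[a]intz !scaler_int; case: a => n; first by rewrite -!pmulrn fn.
by rewrite NegzE !mulrNz fN -!pmulrn fn.
Qed.

Definition divisible (D : lmodType int) : Prop :=
  forall n : int, n != 0 -> forall x : D, exists y, n *: y = x.

(** Baer's argument through Zorn's lemma, starting from the map induced by [f] on the image of [u]
    and adjoining one element [b] at a time. *)
Lemma divisible_injective D : divisible D -> injective_mod D.
Proof.
move=> divD A B u f uf.
have s0 : submodule (fun y : B => y = 0).
  by split=> // a x y -> ->; rewrite scaler0 addr0.
have [||h0 h0E] := @linear_on_glue _ B D _ (fun=> 0) s0 _ A u f.
- by move=> a x y _ _; rewrite scaler0 addr0.
- by move=> v /uf.
have h0u v : h0 (u v) = f v by rewrite -[u v]add0r h0E // add0r.
pose Phi (p : @partial_fun unit (fun=> B) (fun=> D)) :=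
  [/\ submodule (p.1 tt), linear_on (p.1 tt) (p.2 tt) &
      forall x, p.1 tt (u x) /\ p.2 tt (u x) = f x].
have [|S h [p Sp] SP Stot hE|[N h] [] b /= [sN lh Nu] nNb|h [_ lh hu]] :=
    @zorn_extension unit (fun=> B) (fun=> D) Phi
      (fun _ y => exists x, u x = y, fun=> h0).
- split=> [|a _ _ [x <-] [y <-]|x] /=; last by split=> //; exists x.
    split=> [|a _ _ [x <-] [y <-]]; first by exists 0; rewrite linear0.
    by exists (a *: x + y); rewrite linearP.
  by rewrite -linearP !h0u linearP.
- have common x y : (exists2 q, S q & q.1 tt x) -> (exists2 q, S q & q.1 tt y) ->
      exists q, [/\ S q, q.1 tt x & q.1 tt y].
    move=> [q Sq qx] [r Sr ry].
    have [qr|rq] := Stot q r Sq Sr; [exists r | exists q]; split=> //.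
      by case: (qr tt x qx).
    by case: (rq tt y ry).
  split=> [|a x y Ux Uy|x] /=.
  + split=> [|a x y Ux Uy].
      by exists p => //; case: (SP p Sp) => [[]].
    have [q [Sq qx qy]] := common x y Ux Uy.
    by exists q => //; case: (SP q Sq) => [[_ +] _ _]; apply.
  + have [q [Sq qx qy]] := common x y Ux Uy; have [sq lq _] := SP q Sq.
    by rewrite !(hE q) //; [exact: lq | exact: sq.2].
  + have [_ _ /(_ x) [px fx]] := SP p Sp.
    by split; [exists p | rewrite (hE p)].
- rewrite /= in sN lh nNb; have N0 : N tt 0 by case: sN.
  have h0' : h tt 0 = 0 by exact: (linear_on0 sN lh).
  (* [y] is a possible value at [b]: if [n] is the least positive integer with [n *: b] in the
     domain, it is an [n]-th part of the value there; without such [n] it is 0. *)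
  have [y yP] : exists y : D, forall k : int, N tt (k *: b) -> h tt (k *: b) = k *: y.
    have [ex|nex] := pselect (exists n, (0 < n)%N && `[< N tt (n%:Z *: b) >]);
      last first.
      exists 0 => k Nk; have [->|k0] := eqVneq k 0.
        by rewrite !scale0r.
      case: nex; exists `|k|%N; rewrite absz_gt0 k0; apply/asboolP.
      by rewrite abszEsign -scalerA; exact: submoduleZ.
    case: (ex_minnP ex) => n /andP[n0 /asboolP Nn] nmin.
    have nz : n%:Z != 0 by rewrite eqz_nat -lt0n.
    have [y yE] := divD n%:Z nz (h tt (n%:Z *: b)); exists y => k Nk.
    have r0 : (k %% n)%Z = 0.
      apply: contrapT => /eqP r0.
      have rn : (`|(k %% n)%Z| < n)%N by rewrite -ltz_nat gez0_abs ?modz_ge0 // ltz_mod.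
      have /nmin : (0 < `|(k %% n)%Z|)%N && `[< N tt (`|(k %% n)%Z|%:Z *: b) >].
        rewrite absz_gt0 r0; apply/asboolP; rewrite gez0_abs ?modz_ge0 //.
        have -> : (k %% n)%Z = k - (k %/ n)%Z * n.
          by rewrite {2}(divz_eq k n) addrC addKr.
        by rewrite scalerBl -scalerA; apply: submoduleB => //; exact: submoduleZ.
      by rewrite leqNgt rn.
    rewrite (divz_eq k n) r0 addr0 -!scalerA yE.
    exact: (linear_onZ sN lh).
  have [a x y0|g gE] := @linear_ex int (int^o : lmodType int) B (fun k : int => k *: b).
    by rewrite scalerDl scalerA.
  have [a x y0|e eE] := @linear_ex int (int^o : lmodType int) D (fun k : int => k *: y).
    by rewrite scalerDl scalerA.
  have [k|h' h'E] := @linear_on_glue _ B D _ (h tt) sN lh _ g e.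
    by rewrite gE eE; exact: yP.
  have h'N x : N tt x -> h' x = h tt x.
    by move=> Nx; have := h'E x 0 Nx; rewrite !linear0 !addr0.
  exists (fun _ x => exists z k, N tt z /\ x = z + g k, fun=> h'); split; first 1 last.
  + by move=> [] x Nx /=; split; [exists x, 0; rewrite linear0 addr0 | exact: h'N].
  + by exists 0, 1; rewrite gE scale1r add0r.
  split=> [|a _ _ [x [k [Nx ->]]] [z [l [Nz ->]]]|x] /=.
  + split=> [|a _ _ [x [k [Nx ->]]] [z [l [Nz ->]]]].
      by exists 0, 0; rewrite linear0 addr0.
    exists (a *: x + z), (a *: k + l); split; first exact: sN.2.
    by rewrite linearP scalerDr addrACA.
  + rewrite scalerDr addrACA -linearP !h'E //; last exact: sN.2.
    by rewrite lh // linearP scalerDr addrACA.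
  + have [Nx fx] := Nu x; split; last by rewrite h'N.
    by exists (u x), 0; rewrite linear0 addr0.
have [g gE] := linear_ex (fun a x y => lh a x y I I).
by exists g => x; rewrite gE; case: (hu x).
Qed.

(** [M] is the free abelian group on [M] modulo the kernel of evaluation; dividing the rational
    vector space on [M] by the same kernel gives [D]. *)
Lemma divisible_hull (M : zmodType) : exists (D : lmodType int) (i : M -> D),
  [/\ divisible D, forall x y, i (x + y) = i x + i y & forall x, i x = 0 -> x = 0].
Proof.
pose F : lmodType int := zmodule (free_mod rat M).
pose dl (x : M) : F := free_gen rat x.
have [T TE] := @free_linear int M F dl.
have [ev evE] := @free_linear int M (zmodule M : lmodType int) id.
have sK : submodule (fun y : F => exists g, ev g = 0 /\ T g = y).
  split=> [|a _ _ [g [g0 <-]] [h [h0 <-]]]; first by exists 0; rewrite !linear0.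
  by exists (a *: g + h); rewrite !linearP g0 h0 scaler0 addr0.
have [D [p [sp kp]]] := quotient_ex sK.
have gen_coef (x y : M) :
    (free_gen rat x y : rat) = ((free_gen int x y : int)%:~R : rat).
  have [<-|xy] := eqVneq x y; first by rewrite !ds_in_eq.
  by rewrite !ds_in_neq.
have Tc (g : free_mod int M) x : (T g : free_mod rat M) x = (g x : int)%:~R.
  have [|c1 c1E] := @linear_ex int F (zmodule rat : lmodType int)
    (fun z => (z : free_mod rat M) x); first exact: int_linear.
  have [|c2 c2E] := @linear_ex int (free_mod int M) (zmodule rat : lmodType int)
    (fun z => (z x : int)%:~R : rat).
    by apply: int_linear => y z; rewrite -intrD.
  rewrite -[LHS]c1E -[RHS]c2E.
  apply: (free_linear_eq (f := (c1 \o T)%FUN) (g := c2)) => y /=.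
  by rewrite TE c1E c2E gen_coef.
exists D, (fun x => p (dl x)); split=> [n n0 x|x y|x /kp [g [g0 Tg]]].
- have [z <-] := sp x; exists (p ((n%:~R : rat)^-1 *: (z : free_mod rat M))).
  rewrite -linearZ; congr (p _).
  have := scaler_int n ((n%:~R : rat)^-1 *: (z : free_mod rat M)).
  by rewrite scalerA mulfV ?intr_eq0 // scale1r => /esym.
- rewrite -linearD; apply/eqP; rewrite -subr_eq0 -linearB; apply/eqP/kp.
  exists (free_gen int (x + y) - (free_gen int x + free_gen int y)).
  rewrite linearB linearD !evE subrr; split=> //.
  by rewrite linearB linearD !TE.
have gx : g = free_gen int x.
  apply: dirsumP => y; apply: (@intr_inj rat).
  by rewrite -[LHS]Tc Tg -gen_coef.
by rewrite -[x]evE -gx.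
Qed.

End Divisible.

(** * Coinduced modules *)

Section Coinduced.
Variables (R : pzRingType) (D : zmodType).

(** The group of additive maps from [R] to [D], a left module by letting [a] send [u] to the map [r]
    to [u (r * a)]. *)
Record coind := Coind {
  coind_fun :> R -> D;
  coindD : forall x y, coind_fun (x + y) = coind_fun x + coind_fun y
}.

Lemma coindP (u v : coind) : (forall r, u r = v r) -> u = v.
Proof.
case: u v => [u uP] [v vP] /= uv.
have euv : u = v by exact: functional_extensionality_dep.
by case: _ / euv vP => vP; congr Coind; exact: Prop_irrelevance.
Qed.

HB.instance Definition _ := gen_eqMixin coind.
HB.instance Definition _ := gen_choiceMixin coind.

Fact coind_zeroD (x y : R) : (0 : D) = 0 + 0.
Proof. by rewrite addr0. Qed.
Fact coind_oppD (u : coind) x y : - u (x + y) = - u x + - u y.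
Proof. by rewrite coindD opprD. Qed.
Fact coind_addD (u v : coind) x y :
  u (x + y) + v (x + y) = u x + v x + (u y + v y).
Proof. by rewrite !coindD addrACA. Qed.
Fact coind_scaleD a (u : coind) x y : u ((x + y) * a) = u (x * a) + u (y * a).
Proof. by rewrite mulrDl coindD. Qed.

Definition coind_zero := Coind coind_zeroD.
Definition coind_opp u := Coind (coind_oppD u).
Definition coind_add u v := Coind (coind_addD u v).
Definition coind_scale a u := Coind (coind_scaleD a u).

Fact coind_addA : associative coind_add.
Proof. by move=> u v w; apply: coindP => r /=; rewrite addrA. Qed.
Fact coind_addC : commutative coind_add.
Proof. by move=> u v; apply: coindP => r /=; rewrite addrC. Qed.
Fact coind_add0 : left_id coind_zero coind_add.
Proof. by move=> u; apply: coindP => r /=; rewrite add0r. Qed.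
Fact coind_addN : left_inverse coind_zero coind_opp coind_add.
Proof. by move=> u; apply: coindP => r /=; rewrite addNr. Qed.

HB.instance Definition _ :=
  GRing.isZmodule.Build coind coind_addA coind_addC coind_add0 coind_addN.

Fact coind_scaleA a b u : coind_scale a (coind_scale b u) = coind_scale (a * b) u.
Proof. by apply: coindP => r /=; rewrite mulrA. Qed.
Fact coind_scale1 : left_id 1 coind_scale.
Proof. by move=> u; apply: coindP => r /=; rewrite mulr1. Qed.
Fact coind_scaleDr : right_distributive coind_scale +%R.
Proof. by move=> a u v; apply: coindP. Qed.
Fact coind_scaleDl u : {morph coind_scale^~ u : a b / a + b}.
Proof. by move=> a b; apply: coindP => r /=; rewrite mulrDr coindD. Qed.

HB.instance Definition _ := GRing.Zmodule_isLmodule.Build R coind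
  coind_scaleA coind_scale1 coind_scaleDr coind_scaleDl.

End Coinduced.

(** Adjunction: evaluation at 1 turns [f] into an additive map to [D]; an additive extension [psi]
    returns the linear map sending [b] to [r] to [psi (r *: b)]. *)
Lemma coind_injective (R : pzRingType) (D : lmodType int) :
  divisible D -> injective_mod (coind R D : lmodType R).
Proof.
move=> divD A B u f uf.
have [|phi phiE] := @linear_ex int (zmodule A : lmodType int) D
    (fun a => (f a : coind R D) 1).
  by apply: int_linear => x y; rewrite linearD.
have [|v vE] := @linear_ex int (zmodule A : lmodType int) (zmodule B : lmodType int) u.
  by apply: int_linear => x y; exact: linearD.
have [x|psi psiE] := divisible_injective divD (u := v) (f := phi).
  by rewrite vE phiE => /uf ->.
have psiD (b : B) (r s : R) : psi ((r + s) *: b) = psi (r *: b) + psi (s *: b).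
  by rewrite scalerDl; exact: linearD.
have [a x y|g gE] := @linear_ex R B (coind R D) (fun b => Coind (psiD b)).
  apply: coindP => r /=; rewrite scalerDr scalerA; exact: linearD.
exists g => a; apply: coindP => r; rewrite gE /= -linearZ.
have := psiE (r *: a); rewrite vE phiE => ->.
by rewrite linearZ /= mul1r.
Qed.

Lemma enough_injectives (R : pzRingType) (M : lmodType R) :
  exists (E : lmodType R) (j : {linear M -> E}),
    injective_mod E /\ forall x, j x = 0 -> x = 0.
Proof.
have [D [i [divD iD i0]]] := divisible_hull M.
have jD (m : M) (r s : R) : i ((r + s) *: m) = i (r *: m) + i (s *: m).
  by rewrite scalerDl iD.
have [a x y|j jE] := @linear_ex R M (coind R D) (fun m => Coind (jD m)).
  by apply: coindP => r /=; rewrite scalerDr scalerA iD.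
exists (coind R D), j; split=> [|x]; first exact: coind_injective.
by rewrite jE => /(congr1 (fun u : coind R D => u 1)) /= /i0; rewrite scale1r.
Qed.

(** * Coresolutions of strongly fp-injective modules *)

Section Coresolution.
Variable R : pzRingType.

Lemma injective_solvable (E : lmodType R) : injective_mod E -> fp_solvable E.
Proof. by move=> injE m n f w fw; exact: injE. Qed.

Lemma strongly_fp_solvable (J : lmodType R) : strongly_fp_injective J -> fp_solvable J.
Proof. by move=> sJ; apply: fp_injective_solvable => T fpT; exact: sJ. Qed.

(** Dimension shifting on cochains: [phi] lifts to [a] in [E], and the coboundary of [a] is a
    cocycle of the next degree in [J]. Bounding it by [psi] makes [a - j psi] a cocycle in [E],
    where injectivity applies. *)
Lemma strongly_fp_injective_quotient (J E C : lmodType R) (j : {linear J -> E})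
    (p : {linear E -> C}) :
  strongly_fp_injective J -> injective_mod E -> (forall x, j x = 0 -> x = 0) ->
  exact_at j p -> surjective p -> strongly_fp_injective C.
Proof.
move=> sJ injE j0 jp sp T fpT [//|k] _ Q phi cphi.
have [a aE] := @res_projective _ _ Q k.+1 _ _ p phi sp.
have ad x : exists y, j y = (a \o res_diff Q k.+1)%FUN x.
  by apply/jp; rewrite /= aE.
have [chi chiE] := linear_lift_inj j0 ad.
have dd i x : res_diff Q i (res_diff Q i.+1 x) = 0.
  by apply/(@res_exact _ _ Q i); exists x.
have [|psi psiE] := sJ T fpT k.+2 isT Q chi.
  by move=> x; apply: j0; rewrite chiE /= dd linear0.
have [x /(@res_exact _ _ Q k) [y <-]|eta etaE] :=
    injE _ _ (res_diff Q k) (a \- (j \o psi))%R.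
  by rewrite /= -psiE chiE subrr.
exists (p \o eta)%FUN => x; rewrite /= etaE linearB /= aE.
have -> : p (j (psi x)) = 0 by apply/jp; exists (psi x).
by rewrite subr0.
Qed.

(** Strong fp-injectivity is stored as an implication, so that the modules [cosyz n] can be defined
    by recursion without carrying proofs. *)
Record cosyzygy (C : lmodType R) := Cosyzygy {
  cs_inj : lmodType R;
  cs_mod : lmodType R;
  cs_in : {linear C -> cs_inj};
  cs_out : {linear cs_inj -> cs_mod};
  cs_injective : injective_mod cs_inj;
  cs_in0 : forall x, cs_in x = 0 -> x = 0;
  cs_exact : exact_at cs_in cs_out;
  cs_surj : surjective cs_out;
  cs_strongly : strongly_fp_injective C -> strongly_fp_injective cs_mod
}.

Lemma cosyzygy_ex C : exists _ : cosyzygy C, True.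
Proof.
have [E [j [injE j0]]] := enough_injectives C.
have sU : submodule (fun y => exists x, j x = y).
  split=> [|a _ _ [x <-] [y <-]]; first by exists 0; rewrite linear0.
  by exists (a *: x + y); rewrite linearP.
have [Q [p [sp kp]]] := quotient_ex sU.
suff sQ : strongly_fp_injective C -> strongly_fp_injective Q.
  by exists (Cosyzygy injE j0 kp sp sQ).
by move=> sC; apply: (strongly_fp_injective_quotient sC injE j0 kp sp).
Qed.

Variable J : lmodType R.
Hypothesis sJ : strongly_fp_injective J.

Fixpoint cosyz n : lmodType R :=
  if n is m.+1 then cs_mod (sval (cid (cosyzygy_ex (cosyz m)))) else J.

Definition cosyz_step n : cosyzygy (cosyz n) := sval (cid (cosyzygy_ex (cosyz n))).

Lemma cosyz_strongly n : strongly_fp_injective (cosyz n).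
Proof.
elim: n => [|n IH]; first exact: sJ.
have h := @cs_strongly _ (cosyz_step n) IH.
exact h.
Qed.

(* The acyclic complex 0 -> J -> E_0 -> E_1 -> ..., with 0 in degree 0. *)
Definition cores (n : nat) : lmodType R :=
  match n with
  | 0 => 'rV[R]_0
  | 1 => J
  | k.+2 => cs_inj (cosyz_step k)
  end.

Definition cores_diff (n : nat) : {linear cores n -> cores n.+1} :=
  match n with
  | 0 => \0%R
  | 1 => cs_in (cosyz_step 0)
  | k.+2 => (cs_in (cosyz_step k.+1) \o
      (cs_out (cosyz_step k) : {linear _ -> cosyz k.+1}))%FUN
  end.

Lemma cores_diffK n x : cores_diff n.+1 (cores_diff n x) = 0.
Proof.
have oi k y : cs_out (cosyz_step k) (cs_in (cosyz_step k) y) = 0.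
  by apply/cs_exact; exists y.
by case: n x => [|[|k]] x /=; rewrite ?linear0 // oi linear0.
Qed.

Lemma cores_exact n x : cores_diff n.+1 x = 0 -> exists y, cores_diff n y = x.
Proof.
case: n x => [|[|k]] x /=.
- by move=> /cs_in0 ->; exists 0.
- by move=> /cs_in0 /cs_exact.
move=> /cs_in0 /cs_exact [c <-]; have [e <-] := @cs_surj _ (cosyz_step k) c.
by exists e.
Qed.

Lemma cores_solvable n : fp_solvable (cores n).
Proof.
case: n => [|[|k]] /=.
- by move=> m n f w _; exists \0%R => v; apply/rowP; case.
- exact: strongly_fp_solvable.
- exact/injective_solvable/cs_injective.
Qed.

(** The cocycle modules are zero in degrees 0 and 1, and [cosyz k] in degree [k.+2]. *)
Lemma cores_ker_solvable n : fp_solvable (ker (cores_diff n)).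
Proof.
move=> m l f w fw; case: n w fw => [|[|k]] w fw.
- by exists \0%R => v; apply: val_inj; apply/rowP; case.
- exists \0%R => v; apply: val_inj => /=.
  by have /cs_in0 -> := ker_valK (w v).
have [a x y|w0 w0E] := @linear_ex R 'rV_m (cores k.+2) (fun v => ker_val (w v)).
  by rewrite linearP.
have wc v : exists c, cs_in (cosyz_step k) c = w0 v.
  by apply/cs_exact; rewrite w0E; have /cs_in0 := ker_valK (w v).
have [w1 w1E] := linear_lift_inj (@cs_in0 _ (cosyz_step k)) wc.
have [v fv0|y yE] := strongly_fp_solvable (@cosyz_strongly k) (f := f) (w := w1).
  by apply: (@cs_in0 _ (cosyz_step k)); rewrite w1E w0E fw.
have [v|z zE] := @linear_lift_ker R _ _ _
    (cs_in (cosyz_step k) \o y)%FUN (cores_diff k.+2).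
  rewrite /=; have -> : cs_out (cosyz_step k) (cs_in (cosyz_step k) (y v)) = 0.
    by apply/cs_exact; exists (y v).
  exact: linear0.
by exists z => v; apply: val_inj; rewrite /= zE /= yE w1E w0E.
Qed.

End Coresolution.

(** * Complexes of fp-projective modules *)

Section NullHomotopyFpProjective.
Variables (R : pzRingType) (I : Type) (s : I -> I).
Hypothesis s_inj : forall i j j', iter j s i = iter j' s i -> j = j'.
Variables (P J : I -> lmodType R).
Variables (dP : forall i, {linear P i -> P (s i)}).
Variables (dJ : forall i, {linear J i -> J (s i)}).
Hypothesis ddP : forall i x, dP (s i) (dP i x) = 0.
Hypothesis ddJ : forall i x, dJ (s i) (dJ i x) = 0.
Hypothesis exJ : forall i x, dJ (s i) x = 0 -> exists y, dJ i y = x.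
Hypothesis solZ : forall i, fp_solvable (ker (dJ i)).
Hypothesis solJ : forall i, fp_solvable (J i).
Hypothesis Pfp : forall i, fp_projective (P i).
Variable f : forall i, {linear P i -> J (s i)}.
Hypothesis fd : forall i x, f (s i) (dP i x) = dJ (s i) (f i x).

(** The cellular modules form a complex with differential [se dP pr], since [pr se] is the identity;
    a homotopy for [f pr] is restricted along [se]. *)
Lemma fp_projective_null_homotopic : exists h : forall i, {linear P i -> J i},
  forall i x, f i x = dJ i (h i x) + h (s i) (dP i x).
Proof.
pose M i := sval (cid (fp_projective_retract (@Pfp i))).
pose pr i := sval (cid (svalP (cid (fp_projective_retract (@Pfp i))))) :
  {linear M i -> P i}.
pose se i := sval (cid (svalP (cid (svalP (cid (fp_projective_retract (@Pfp i))))))) :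
  {linear P i -> M i}.
have MP i : exists H : (M i -> Prop) -> Prop,
    hill_family H /\ forall x, pr i (se i x) = x.
  exact: (svalP (cid (svalP (cid (svalP (cid (fp_projective_retract (@Pfp i)))))))).
pose H i := sval (cid (MP i)).
have HH i : hill_family (H i) by case: (svalP (cid (MP i))).
have prK i x : pr i (se i x) = x by case: (MP i) => K [].
pose dM i : {linear M i -> M (s i)} := (se (s i) \o (dP i \o pr i))%FUN.
have [|i x|h hE] := @hill_null_homotopic R I s s_inj M J dM dJ _ ddJ exJ solZ solJ H HH
  (fun i => f i \o pr i)%FUN.
- by move=> i x; rewrite /dM /= prK ddP linear0.
- by rewrite /= prK fd.
exists (fun i => h i \o se i)%FUN => i x.
by have := hE i (se i x); rewrite /= prK.
Qed.

End NullHomotopyFpProjective.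

Lemma int_iter_inj (i : int) (j j' : nat) :
  iter j (fun k : int => k + 1) i = iter j' (fun k : int => k + 1) i -> j = j'.
Proof.
have itE n : iter n (fun k : int => k + 1) i = i + n%:Z.
  by elim: n => [|n IH]; rewrite /= ?addr0 // IH -addrA -[1]/(1%:Z) -PoszD addn1.
by rewrite !itE => /addrI [].
Qed.

Lemma nat_iter_inj (i j j' : nat) : iter j S i = iter j' S i -> j = j'.
Proof.
have itE n : iter n S i = (n + i)%N by elim: n => //= n ->.
by rewrite !itE => /addIn.
Qed.

(** * Cocycle modules of an acyclic complex of fp-projective modules *)

Section Cocycles.
Variables (R : pzRingType) (P : complex R).
Hypotheses (acP : acyclic P) (Pfp : forall i, fp_projective (P i)).

Lemma cocycle_map_ex i : exists dl : {linear P i -> cocycles P (i + 1)},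
  (forall x, ker_val (dl x) = cplx_diff P i x) /\ surjective dl.
Proof.
have [dl dlE] := linear_lift_ker (@cplx_diffK _ P i).
exists dl; split=> // z; have [x xz] : exists x, cplx_diff P i x = ker_val z.
  by apply/acP; exact: ker_valK.
by exists x; apply: val_inj; rewrite /= dlE.
Qed.

(** The truncation of [P] from degree [k] on is mapped to the coresolution of [J], beginning with
    [g dl]; a null-homotopy of this map contains the extension. *)
Lemma cocycle_extend k (J : lmodType R) (g : {linear cocycles P (k + 1) -> J}) :
  strongly_fp_injective J ->
  exists G : {linear P (k + 1) -> J}, forall z, G (ker_val z) = g z.
Proof.
move=> sJ; have [dl [dlE sdl]] := cocycle_map_ex k.
pose Q j := P (iter j (fun i : int => i + 1) k).
pose dQ j : {linear Q j -> Q j.+1} := cplx_diff P (iter j (fun i : int => i + 1) k).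
pose f0 : {linear Q 0%N -> cores J 1} := (g \o dl)%FUN.
(* Each next map extends a map along [dQ j] into an injective module; acyclicity of [P] keeps the
   composite zero on cocycles. *)
have [x dx0|j f fP|f [f0E fP]] := @dependent_choice_seq
    (fun j => {linear Q j -> cores J j.+1})
    (fun j f => forall x, dQ j x = 0 -> cores_diff J j.+1 (f x) = 0)
    (fun j f f' => forall x, f' (dQ j x) = cores_diff J j.+1 (f x)) f0.
- have dl0 : dl x = 0 by apply: val_inj; rewrite /= dlE.
  have -> : f0 x = 0 := etrans (congr1 g dl0) (linear0 g).
  exact: linear0.
- have [f' f'E] := @cs_injective _ _ (cosyz_step J j) _ _ (dQ j)
    (cores_diff J j.+1 \o f)%FUN fP.
  exists f'; split=> [x /acP [y <-]|x]; last exact: f'E.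
  by have := f'E y => /= ->; exact: (@cores_diffK _ J j.+1).
have [j x|j x|j x|j|j|j x|h hE] := @fp_projective_null_homotopic R nat S nat_iter_inj
    Q (cores J) dQ (cores_diff J) _ _ _ _ _ (fun j => @Pfp _) f _.
- exact: cplx_diffK.
- exact: cores_diffK.
- exact: cores_exact.
- exact: cores_ker_solvable.
- exact: cores_solvable.
- by case: (fP j).
(* The differential out of [cores J 0] is zero, so the homotopy identity in degree 0 reads
   [g (dl x) = h 1 (d x)]. *)
exists (h 1%N) => z; have [x <-] := sdl z.
have hx : g (dl x) = 0 + h 1%N (cplx_diff P k x).
  by have := hE 0%N x; rewrite f0E.
rewrite dlE hx; exact/esym/add0r.
Qed.

End Cocycles.

Theorem theorem0p8 (R : pzRingType) :
  (forall P : complex R,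
     acyclic P ->
     (forall i : int, fp_projective (P i)) ->
     forall i : int, weakly_fp_projective (cocycles P i))
  /\
  (forall P J : complex R,
     (forall i : int, fp_projective (P i)) ->
     acyclic J ->
     (forall i : int, fp_injective (J i)) ->
     (forall i : int, fp_injective (cocycles J i)) ->
     forall f : complex_morphism P J, null_homotopic f).
Proof.
split=> [P acP Pfp i J sJ|P J Pfp acJ Jfp Zfp f]; last first.
  (* [P] is reindexed by one, so that [f] in degree [i + 1] takes the form of a map into
     [J (s i)]. *)
  have [i x|i x|i x|i|i|i x|h hE] :=
    @fp_projective_null_homotopic R int (fun i => i + 1)
      int_iter_inj (fun i => P (i + 1)) J (fun i => cplx_diff P (i + 1))
      (cplx_diff J) _ _ _ _ _ (fun i => Pfp (i + 1)) (fun i => f (i + 1)) _.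
  - exact: cplx_diffK.
  - exact: cplx_diffK.
  - by move/acJ.
  - exact/fp_injective_solvable/Zfp.
  - exact/fp_injective_solvable/Jfp.
  - exact: cmor_comm.
  by exists h.
(* Two steps down are needed: the cocycles in degree [k + 1 + 1] are a quotient of [P (k + 1)],
   whose cocycles are in turn a quotient of [P k]. *)
have [k ->] : exists k, i = k + 1 + 1 by exists (i - 1 - 1); rewrite !subrK.
apply: split_Ext1 => X io p io0 iop sp.
have [dl [dlE sdl]] := cocycle_map_ex acP (k + 1).
(* The kernel of [phi] is the pullback of the extension [X] along [dl]. It splits over [P (k + 1)],
   which lifts [dl] to a map [a] into [X]. *)
pose P1 : lmodType R := P (k + 1).
have [a x y|phi phiE] := @linear_ex R (X * P1)%type (cocycles P (k + 1 + 1))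
    (fun z => p z.1 - dl (z.2 : P1)).
  by rewrite !linearP /= scalerBr addrACA scalerN.
have [a x y|j0 j0E] := @linear_ex R J (X * P1)%type (fun j => (io j, 0)).
  by rewrite linearP; congr (_, _); rewrite /= scaler0 addr0.
have [j|j jE] := linear_lift_ker (f := j0) (g := phi).
  rewrite j0E phiE linear0 subr0 /=; apply/iop; by exists j.
have [a x y|q qE] := @linear_ex R (ker phi) (P (k + 1)) (fun y => (ker_val y).2).
  by [].
have Ext1P : Ext_eq0 1 (P (k + 1)) J.
  by apply: Pfp => T fpT; exact: sJ.
have [x|y|x|t tE] := Ext1_split (i := j) (p := q) Ext1P.
- move=> /(congr1 (fun y => (ker_val y).1)) /=; rewrite jE j0E /=; exact: io0.
- split=> [qy|[x <-]]; last by rewrite qE jE j0E.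
  have := ker_valK y; rewrite phiE -qE qy linear0 subr0 => /iop [x xE].
  exists x; apply: val_inj; rewrite /= jE j0E xE -qy qE.
  by case: (ker_val y).
- have [z zE] := sp (dl x).
  have kz : (z, x) \in ker_pred phi by apply/eqP; rewrite phiE zE subrr.
  by exists (Ker kz); rewrite qE.
have [b u v|a aE] := @linear_ex R (P (k + 1)) X (fun x => (ker_val (t x)).1).
  by rewrite linearP.
have pa x : p (a x) = dl x.
  have := ker_valK (t x); rewrite phiE -qE tE aE => /eqP.
  by rewrite subr_eq0 => /eqP.
have az (z : cocycles P (k + 1)) : exists y, io y = a (ker_val z).
  by apply/iop; rewrite pa; apply: val_inj; rewrite /= dlE ker_valK.
have [b u v|a' a'E] := @linear_ex R (cocycles P (k + 1)) X (fun z => a (ker_val z)).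
  by rewrite -linearP.
have [z|g gE] := linear_lift_inj (f := a') io0; first by rewrite a'E.
(* On cocycles [a] takes values in [J]; subtracting an extension [G] of this restriction makes [a]
   vanish on them and descend to a section. *)
have [G GE] := cocycle_extend acP Pfp g sJ.
have [x dx|s sE] := linear_factor sdl (f := (a \- (io \o G))%R).
  have kx : x \in ker_pred (cplx_diff P (k + 1)) by apply/eqP; rewrite -dlE dx.
  by have := GE (Ker kx) => /= ->; rewrite gE a'E subrr.
exists s => z; have [x <-] := sdl z; rewrite sE linearB /= pa.
have -> : p (io (G x)) = 0 by apply/iop; exists (G x).
by rewrite subr0.
Qed.
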